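(* Let $n\in\mathbb{N}$. (1) An element $g\in G_f(X)$ belongs to $\overline{G_f(X)}_n$ if and only if all basic iterated integrals $\widehat I_{i_1,\dots,i_k}$ of order $k\le n$ (with $k\geq 1$) vanish at $g$. (2) $\overline{G(X)}_n=\overline{G_f(X)}_n\cap G(X)$.
   Context: Lower central series. For a topological group $H$ put $H_1=[H,H]$ (commutator subgroup) and $H_n=[H,H_{n-1}]$ for $n\ge2$; $\overline{H}_n$ denotes the closure of $H_n$ in $H$. The sequence $H\supset\overline H_1\supset\overline H_2\supset\cdots$ is the topological lower central series of $H$. Algebra. Let $\mathbb{C}\langle X_1,X_2,\dots\rangle$ be the associative algebra with unit $I$ of complex noncommutative polynomials in free noncommuting variables $X_1,X_2,\dots$. Let $\mathcal{A}\subset\mathbb{C}\langle X_1,X_2,\dots\rangle[[t]]$ be the subalgebra of formal power series of the form $f=c_0I+\sum_{n\ge1}\big(\sum_{i_1+\cdots+i_k=n}c_{i_1,\dots,i_k}X_{i_1}\cdots X_{i_k}\big)t^n$ with complex coefficients (inner sum over all $k\ge1$ and all $(i_1,\dots,i_k)\in\mathbb{N}^k$ with sum $n$). Equip $\mathcal{A}$ with the weakest topology making all coefficient functions continuous. Let $G\subset\mathcal{A}$ be the topological group (under multiplication) of elements with $c_0=1$. Paths. Fix $T>0$, $I_T=[0,T]$. $X$ is the set of sequences $a=(a_1,a_2,\dots)$ of complex-valued functions $a_i\in L^\infty(I_T)$ with $\sup_{x\in I_T,\,i\in\mathbb{N}}|a_i(x)|^{1/i}<\infty$. For $a\in X$ let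 $F_a:I_T\to G$ be the solution (by Picard iteration, with coefficients Lipschitz in $x$) of $F'(x)=\big(\sum_{i\ge1}a_i(x)t^iX_i\big)F(x)$, $F_a(0)=I$, and set $E(a)=F_a(T)\in G$. The set $G(X):=E(X)$ is a subgroup of $G$ (the group of paths), and the group of formal paths $G_f(X)$ is the closure of $G(X)$ in $G$; both carry the topology induced from $G$. (The paper defines $G(X)$ as a quotient of $X$ and $G_f(X)$ as its metric completion, and identifies them with these subgroups of $G$.) Basic iterated integrals. For $a\in X$ and $i_1,\dots,i_k\in\mathbb{N}$, $$I_{i_1,\dots,i_k}(a)=\int\cdots\int_{0\le s_1\le\cdots\le s_k\le T}a_{i_k}(s_k)\cdots a_{i_1}(s_1)\,ds_k\cdots ds_1.$$ The number $k$ is its order. $\widehat I_{i_1,\dots,i_k}:G_f(X)\to\mathbb{C}$ is the unique continuous function with $\widehat I_{i_1,\dots,i_k}(E(a))=I_{i_1,\dots,i_k}(a)$ for all $a\in X$; these functions are the basic iterated integrals on $G_f(X)$. *)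

(* Defs.v *)
From HB Require Import structures.
From mathcomp Require Import all_boot all_order all_algebra.
From mathcomp Require Import complex.
From mathcomp Require Import all_classical all_reals all_analysis.

Set Implicit Arguments.
Unset Strict Implicit.
Unset Printing Implicit Defensive.

Import Order.TTheory GRing.Theory Num.Theory.
Import numFieldNormedType.Exports.

Local Open Scope classical_set_scope.
Local Open Scope ring_scope.

(* Naming the numClosedFieldType structure of R[i] gives access to the norm
   topology, which the library attaches to structures of numeric fields and
   not to the bare type R[i]. *)
Definition Cplx (R : realType) : numClosedFieldType := R[i].

(* A letter i : nat stands for X_{i+1}, so that letters range over X_1, X_2, ...
   and the word [:: i_1; ...; i_k] for X_{i_1+1} ... X_{i_k+1}. *)
Definition word := seq nat.

(* The algebra A.  In an element of A the coefficient of t^n is a combination of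
   the finitely many monomials of weight n, where X_i has weight i: the exponent
   of t is determined by the monomial, and an element of A is the same thing as
   an arbitrary family of coefficients indexed by words.  The topology is the
   weakest one making all the coefficient functions continuous. *)
Definition ncseries (R : realType) : Type := {ptws word -> Cplx R}.

HB.instance Definition _ (R : realType) :=
  Topological.copy (ncseries R) {ptws word -> Cplx R}.
HB.instance Definition _ (R : realType) :=
  GRing.Zmodule.copy (ncseries R) (word -> Cplx R).

Definition sone (R : realType) : ncseries R := fun w => (w == [::])%:R.

(* product of noncommutative power series *)
Definition smul (R : realType) (f g : ncseries R) : ncseries R :=
  fun w => \sum_(k < (size w).+1) f (take k w) * g (drop k w).

Lemma smul_nil (R : realType) (f g : ncseries R) :
  smul f g [::] = f [::] * g [::].
Proof. by rewrite /smul big_ord_recl big_ord0 addr0. Qed.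

Lemma smul_cons (R : realType) (f g : ncseries R) i w :
  smul f g (i :: w) =
  f [::] * g (i :: w) + smul (fun v => f (i :: v)) g w.
Proof. by rewrite /smul /= big_ord_recl. Qed.

Lemma smulA (R : realType) : associative (@smul R).
Proof.
move=> f g h; apply: funext => w.
elim: w f => [|i w IHw] f; first by rewrite !smul_nil mulrA.
rewrite !smul_cons !smul_nil IHw mulrDr mulrA -addrA; congr (_ + _).
rewrite /smul mulr_sumr -big_split /=; apply: eq_bigr => k _.
rewrite mulrA -mulrDl; congr (_ * _).
by rewrite -[RHS]/(smul f g (i :: take k w)) smul_cons.
Qed.

Lemma smul1 (R : realType) : left_id (@sone R) (@smul R).
Proof.
move=> f; apply: funext => w; rewrite /smul big_ord_recl /= take0 drop0.
rewrite /sone eqxx mul1r big1 ?addr0 // => -[k /= kw] _.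
by case: w kw => [|i w] //= _; rewrite mul0r.
Qed.

Lemma smulr1 (R : realType) : right_id (@sone R) (@smul R).
Proof.
move=> f; apply: funext => w; rewrite /smul big_ord_recr /= take_size drop_size.
rewrite /sone eqxx mulr1 big1 ?add0r // => -[k /= kw] _.
by rewrite -size_eq0 size_drop subn_eq0 leqNgt kw mulr0.
Qed.

Lemma smulDl (R : realType) : left_distributive (@smul R) +%R.
Proof.
move=> f g h; apply: funext => w; rewrite /smul -[RHS]big_split /=.
by apply: eq_bigr => k _; rewrite -mulrDl.
Qed.

Lemma smulDr (R : realType) : right_distributive (@smul R) +%R.
Proof.
move=> f g h; apply: funext => w; rewrite /smul -[RHS]big_split /=.
by apply: eq_bigr => k _; rewrite -mulrDr.
Qed.

Lemma sone_neq0 (R : realType) : sone R != 0 :> ncseries R.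
Proof.
by apply/eqP => /(congr1 (@^~ [::])) /eqP; rewrite /sone /= oner_eq0.
Qed.

HB.instance Definition _ (R : realType) :=
  GRing.Zmodule_isNzRing.Build (ncseries R)
    (@smulA R) (@smul1 R) (@smulr1 R) (@smulDl R) (@smulDr R) (sone_neq0 R).

Lemma smulE (R : realType) (f g : ncseries R) w :
  (f * g) w = \sum_(k < (size w).+1) f (take k w) * g (drop k w).
Proof. by []. Qed.

Lemma ncseries_exp_eq0 (R : realType) (u : ncseries R) m w :
  u [::] = 0 -> (size w < m)%N -> (u ^+ m) w = 0.
Proof.
move=> u0; elim: m w => // m IHm w; rewrite ltnS => wm.
rewrite exprS smulE big1 // => -[k kw] _ /=.
case: k kw => [|k] kw; first by rewrite take0 u0 mul0r.
case: w wm kw => [|i w] wm kw; first by rewrite /= u0 mul0r.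
rewrite IHm ?mulr0 // (leq_trans _ wm) // size_drop ltn_subrL.
by rewrite !ltn0Sn.
Qed.

(* f^-1 = \sum_m (1 - f)^m when f has constant coefficient 1 *)
Definition sinv (R : realType) (f : ncseries R) : ncseries R :=
  fun w => (\sum_(m < (size w).+1) (1 - f) ^+ m) w.

Lemma ncseries_sumE (R : realType) (I : Type) (r : seq I) (F : I -> ncseries R) w :
  (\sum_(i <- r) F i) w = \sum_(i <- r) F i w.
Proof.
by apply: (big_morph (fun f : ncseries R => f w) (id1 := 0) (op1 := +%R)).
Qed.

Lemma sinvE (R : realType) (f : ncseries R) n w :
  f [::] = 1 -> (size w <= n)%N ->
  sinv f w = (\sum_(m < n.+1) (1 - f) ^+ m) w.
Proof.
move=> f1 wn; rewrite /sinv -[in RHS](subnKC wn) -addSn big_split_ord /=.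
rewrite -[LHS]addr0; congr (_ + _); rewrite ncseries_sumE big1 // => i _.
rewrite ncseries_exp_eq0 ?ltn_addr //.
by rewrite -[LHS]/(1 - f [::]) f1 subrr.
Qed.

Lemma smulV (R : realType) (f : ncseries R) : f [::] = 1 -> f * sinv f = 1.
Proof.
move=> f1; apply: funext => w; rewrite smulE.
under eq_bigr => k _ do
  rewrite (@sinvE _ _ (size w)) // ?size_drop ?leq_subr //.
rewrite -smulE -{1}[f](subKr 1) -opprB mulNr -subrX1 opprB.
rewrite -[LHS]/(_ - ((1 - f) ^+ _) w) ncseries_exp_eq0 ?subr0 //.
by rewrite -[LHS]/(1 - f [::]) f1 subrr.
Qed.

Lemma sinv_nil (R : realType) (f : ncseries R) : sinv f [::] = 1.
Proof. by rewrite /sinv big_ord_recl big_ord0 addr0 expr0. Qed.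

Lemma smulVl (R : realType) (f : ncseries R) : f [::] = 1 -> sinv f * f = 1.
Proof.
move=> f1; have fV := smulV f1; have gV := smulV (sinv_nil f).
have fE : sinv (sinv f) = f by rewrite -[LHS]mul1r -fV -mulrA gV mulr1.
by rewrite fE in gV.
Qed.

Record grp (R : realType) := Grp {
  grp_val :> ncseries R;
  grp_valP : grp_val [::] == 1
}.

Definition coef (R : realType) (w : word) (g : grp R) : Cplx R := grp_val g w.

HB.instance Definition _ (R : realType) := [isSub for @grp_val R].
HB.instance Definition _ (R : realType) := [Choice of grp R by <:].
HB.instance Definition _ (R : realType) :=
  Topological.copy (grp R) (initial_topology (@grp_val R)).

Fact grp1_subproof (R : realType) : (1 : ncseries R) [::] == 1.
Proof. by []. Qed.
Fact grpM_subproof (R : realType) (g h : grp R) :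
  ((g : ncseries R) * (h : ncseries R)) [::] == 1.
Proof. by rewrite [_ [::]]smul_nil (eqP (grp_valP g)) (eqP (grp_valP h)) mulr1. Qed.
Fact grpV_subproof (R : realType) (g : grp R) : sinv g [::] == 1.
Proof. by rewrite sinv_nil. Qed.

Definition grp1 (R : realType) : grp R := Grp (grp1_subproof R).
Definition grpM (R : realType) (g h : grp R) : grp R := Grp (grpM_subproof g h).
Definition grpV (R : realType) (g : grp R) : grp R := Grp (grpV_subproof g).

Fact grpMA (R : realType) : associative (@grpM R).
Proof. by move=> f g h; apply: val_inj => /=; exact: mulrA. Qed.
Fact grp1M (R : realType) : left_id (grp1 R) (@grpM R).
Proof. by move=> g; apply: val_inj => /=; exact: mul1r. Qed.
Fact grpM1 (R : realType) : right_id (grp1 R) (@grpM R).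
Proof. by move=> g; apply: val_inj => /=; exact: mulr1. Qed.
Fact grpVM (R : realType) : left_inverse (grp1 R) (@grpV R) (@grpM R).
Proof. by move=> g; apply: val_inj => /=; exact/smulVl/eqP/grp_valP. Qed.
Fact grpMV (R : realType) : right_inverse (grp1 R) (@grpV R) (@grpM R).
Proof. by move=> g; apply: val_inj => /=; exact/smulV/eqP/grp_valP. Qed.

HB.instance Definition _ (R : realType) := isGroup.Build (grp R)
  (@grpMA R) (@grp1M R) (@grpM1 R) (@grpVM R) (@grpMV R).

Definition is_subgroup (gT : groupType) (H : set gT) :=
  [/\ H 1%g, forall x y, H x -> H y -> H (x * y)%g
    & forall x, H x -> H (x^-1)%g].

(* the subgroup generated by the commutators [~ x, y], for x in H and y in K *)
Definition commutator_subgroup (gT : groupType) (H K : set gT) : set gT :=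
  smallest (@is_subgroup gT) [set [~ x, y]%g | x in H & y in K].

(* lower_central H n is H_n; thus H_1 = [H, H] *)
Fixpoint lower_central (gT : groupType) (H : set gT) (n : nat) : set gT :=
  if n is m.+1 then commutator_subgroup H (lower_central H m) else H.

(* the closure is taken in H with its induced topology *)
Definition closed_lower_central (R : realType) (H : set (grp R)) (n : nat)
    : set (grp R) :=
  closure (lower_central H n : set (subspace H)).

Definition time_interval (R : realType) (T : R) : set R := `[0, T].

Definition Linfty (R : realType) (T : R) (f : R -> Cplx R) :=
  [/\ measurable_fun (time_interval T) (fun x => complex.Re (f x)),
      measurable_fun (time_interval T) (fun x => complex.Im (f x)) &
      exists M : R, {ae (@lebesgue_measure R),
        forall x, time_interval T x -> Normc.normc (f x) <= M}].

(* The component a i is the function written a_{i+1}, hence the exponent 1/(i+1).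
   The supremum is an essential one, the a i being taken up to null sets. *)
Definition pathX (R : realType) (T : R) : set (nat -> R -> Cplx R) :=
  [set a | (forall i, Linfty T (a i)) /\
    exists M : R, forall i, {ae (@lebesgue_measure R),
      forall x, time_interval T x -> Normc.normc (a i x) `^ (i.+1%:R^-1) <= M}].

(* \sum_(i >= 1) a_i(x) t^i X_i *)
Definition velocity (R : realType) (a : nat -> R -> Cplx R) (x : R) : ncseries R :=
  fun w => if w is [:: i] then a i x else 0.

(* F' = (\sum_(i >= 1) a_i t^i X_i) F holds for almost every x, the a_i being only
   bounded and measurable; derivatives are taken coefficientwise. *)
Definition is_flow (R : realType) (T : R) (a : nat -> R -> Cplx R)
    (F : R -> grp R) :=
  [/\ F 0 = 1%g,
      forall w, [lipschitz complex.Re (coef w (F x)) | x in time_interval T] /\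
                [lipschitz complex.Im (coef w (F x)) | x in time_interval T] &
      {ae (@lebesgue_measure R), forall x, time_interval T x -> forall w,
        is_derive x 1 (fun y => complex.Re (coef w (F y)))
          (complex.Re ((velocity a x * grp_val (F x)) w)) /\
        is_derive x 1 (fun y => complex.Im (coef w (F y)))
          (complex.Im ((velocity a x * grp_val (F x)) w))}].

(* only the restriction of the flow to [0, T] is determined by a *)
Definition flow (R : realType) (T : R) (a : nat -> R -> Cplx R) : R -> grp R :=
  xget (fun=> 1%g) [set F | is_flow T a F].

Definition endpoint (R : realType) (T : R) (a : nat -> R -> Cplx R) : grp R :=
  flow T a T.

Definition group_of_paths (R : realType) (T : R) : set (grp R) :=
  endpoint T @` pathX T.

Definition formal_paths (R : realType) (T : R) : set (grp R) :=
  closure (group_of_paths T).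

Definition cintegral (R : realType) (D : set R) (f : R -> Cplx R) : Cplx R :=
  (\int[@lebesgue_measure R]_(x in D) complex.Re (f x) +i*
   \int[@lebesgue_measure R]_(x in D) complex.Im (f x))%C.

(* integral over s <= s_1 <= ... <= s_k <= T of a_{i_k}(s_k) ... a_{i_1}(s_1),
   with s_1 the outermost variable *)
Fixpoint iterint (R : realType) (T : R) (a : nat -> R -> Cplx R) (w : word)
    (s : R) : Cplx R :=
  if w is i :: v then cintegral `[s, T] (fun u => a i u * iterint T a v u)
  else 1.

(* The continuous extension of E(a) |-> I_w(a) to formal_paths T; its values
   outside this set are arbitrary. *)
Definition basic_integral (R : realType) (T : R) (w : word) : grp R -> Cplx R :=
  xget (fun=> 0) [set phi : grp R -> Cplx R |
    {within formal_paths T, continuous phi} /\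
    forall a, pathX T a -> phi (endpoint T a) = iterint T a w 0].

(* Main.v *)
Require Import Defs.
From HB Require Import structures.
From mathcomp Require Import all_boot all_order all_algebra.
From mathcomp Require Import complex.
From mathcomp Require Import all_classical all_reals all_analysis.
From mathcomp Require Import measurable_realfun ring lra zify.

(* A path a has a flow F with F_(i::w)' = a_i F_w, so the coefficient of E(a) at the
   reversed word is the iterated integral of a, and the shuffle relations hold for
   E(a) (both sides of each relation have the same derivative), hence on the closure
   of the group of paths.  Commutators raise the lowest order of the nonconstant part
   of a series, so n-fold commutators, and limits of such, have no coefficients of
   order 1, ..., n.

   Conversely let g satisfy the shuffle relations and have no coefficients of order
   1, ..., m.  Its terms of order m+1 vanish on proper shuffles, so by Dynkin's formula
   they form, in finitely many letters, a linear combination of iterated brackets of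
   the X_i; as the group of paths contains elements of the form 1 + c X_i + ..., this
   combination is the lowest term of a product of iterated group commutators of paths.
   Dividing by this product kills the terms of order m+1, and finitely many steps
   exhibit an element of the n-th term of the lower central series of the group of
   paths that agrees with g on any given finite set of words. *)

Set Implicit Arguments.
Unset Strict Implicit.
Unset Printing Implicit Defensive.

Import Order.TTheory GRing.Theory Num.Theory.
Import numFieldNormedType.Exports.

Local Open Scope classical_set_scope.
Local Open Scope ring_scope.

(** * Lipschitz functions with prescribed almost everywhere derivative *)

(** The library notion asks for the bound with every large enough constant; a single nonnegative
    constant is easier to combine. *)
Lemma lipschitzP (R : realType) (A : set R) (f : R -> R) :
  [lipschitz f x | x in A] <->
  exists2 L, 0 <= L & forall x y, A x -> A y -> `|f x - f y| <= L * `|x - y|.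
Proof.
split=> [[L [_ fL]]|[L L0 fL]].
  exists (`|L| + 1) => [|x y Ax Ay]; first by rewrite addr_ge0.
  have /fL/(_ (x, y)) : L < `|L| + 1 by rewrite (le_lt_trans (ler_norm _)) ?ltrDl.
  by apply.
exists L; split; first exact: num_real.
move=> M LM [x y] /= [Ax Ay]; apply: le_trans (fL _ _ Ax Ay) _.
by rewrite ler_wpM2r // ltW.
Qed.

Lemma lebesgue_measure_le (R : realType) (A B : set (measurableTypeR R)) :
  measurable A -> measurable B -> A `<=` B ->
  (@lebesgue_measure R A <= @lebesgue_measure R B)%E.
Proof. by move=> mA mB; apply: le_measure; exact: mem_set. Qed.

(* The null set where the derivative is not 0 is covered by an open set U of
   measure e, and |f x - f 0| <= e x + L mu(U `&` [0, x]) propagates along [0, T]. *)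
Lemma lipschitz_ae_derive0 (R : realType) (T : R) (f : R -> R) :
  [lipschitz f x | x in `[0, T]] ->
  {ae @lebesgue_measure R, forall x, `[0, T]%classic x -> is_derive x 1 f 0} ->
  forall x, x \in `[0, T] -> f x = f 0.
Proof.
move=> /lipschitzP[L L0 fL] [B [mB B0 fB]].
pose mu : {measure set (measurableTypeR R) -> \bar R} := @lebesgue_measure R.
suff key (e : R) : 0 < e -> forall x, x \in `[0, T] ->
    `|f x - f 0| <= e * x + L * e.
  move=> x xT; apply/eqP; rewrite -subr_eq0 -normr_le0.
  move: (xT); rewrite in_itv /= => /andP[x0 _].
  apply/ler_addgt0Pl => d d0; rewrite addr0.
  have c0 : 0 < x + L + 1 by lra.
  apply: le_trans (key (d / (x + L + 1)) (divr_gt0 d0 c0) _ xT) _.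
  rewrite [L * _]mulrC -mulrDr mulrAC ler_pdivrMr // ler_pM2l //; lra.
move=> e0.
have [|U [oU BU]] := @lebesgue_regularity_outer R B e mB _ e0.
  by rewrite [X in (X < _)%E](_ : _ = 0%E) // ltry.
rewrite -/mu => muU.
have mU : measurable U by exact: open_measurable.
have {}muU : (mu U < e%:E)%E.
  have UB : U = (U `\` B) `|` B by rewrite setUC setDUK.
  rewrite UB; apply: le_lt_trans (measureU2 _ _ _) _ => //; first exact: measurableD.
  by rewrite [X in (_ + X)%E](_ : _ = 0%E) // adde0.
pose V (x : R) : set R := U `&` `[0, x]%classic.
pose m (x : R) : R := fine (mu (V x)).
have mI x : measurable (V x) by apply: measurableI.
have mle x : (mu (V x) <= mu U)%E.
  exact: lebesgue_measure_le (mI x) mU (@subIsetl _ _ _).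
have mfin x : (mu (V x) \is a fin_num).
  rewrite ge0_fin_numE ?measure_ge0 //.
  exact: le_lt_trans (mle x) (lt_trans muU (ltry _)).
have me x : m x <= e.
  by rewrite -lee_fin fineK //; apply: le_trans (mle x) (ltW muU).
have m0 x : 0 <= m x by apply: fine_ge0; exact: measure_ge0.
have m_mono x y : x <= y -> m x <= m y.
  move=> xy; rewrite -lee_fin !fineK //.
  apply: (lebesgue_measure_le (mI x) (mI y)).
  apply: setIS => z /=; rewrite !in_itv /= => /andP[-> /le_trans]; exact.
(* Across an interval contained in [U], [m] grows at unit rate at least, so [L * m] pays for the
   Lipschitz growth of [f] there. *)
have m_jump x y : 0 <= x -> x <= y -> `]x, y]%classic `<=` U -> m x + (y - x) <= m y.
  move=> x0 xy xyU.
  pose W : set R := `]x, y]%classic.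
  have muW : mu W = (y - x)%:E.
    rewrite [LHS]lebesgue_measure_itv /= lte_fin; case: ltgtP xy => // -> _.
    by rewrite subrr.
  have -> : y - x = fine (mu W) by rewrite muW.
  have fxy : mu W \is a fin_num. by rewrite muW.
  have VW : V x `&` W = set0.
    rewrite -subset0 => z [[_]]; rewrite /W /= !in_itv /= => /andP[_ zx] /andP[].
    by rewrite ltNge zx.
  have mW : measurable W by exact: measurable_itv.
  rewrite -lee_fin EFinD !fineK //.
  rewrite -[leLHS](measureU mu (mI x) mW VW).
    apply: (lebesgue_measure_le (measurableU _ _ (mI x) mW) (mI y)).
    move=> z [[Uz]|zxy] /=.
      by rewrite !in_itv /= => /andP[z0 /le_trans zx]; split => //; rewrite /= in_itv /= z0 zx.
    split; first exact: xyU.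
    move: zxy; rewrite /W /= in_itv /= => /andP[xz zy].
    by rewrite /= in_itv /= zy (le_trans x0 (ltW xz)).
suff P x : x \in `[0, T] -> `|f x - f 0| <= e * x + L * m x.
  by move=> x xT; apply: le_trans (P _ xT) _; rewrite lerD2l ler_wpM2l.
(* Continuous induction: the estimate passes to the supremum [c] of the points up to [x] where it
   holds, and if [c < x] it persists slightly beyond [c], a contradiction. *)
pose S := [set x | x \in `[0, T] /\ `|f x - f 0| <= e * x + L * m x].
move=> xT; move: (xT); rewrite in_itv /= => /andP[x0 xT'].
have T0 : 0 <= T by apply: le_trans xT'.
pose S' := [set y : R | y <= x /\ S y].
have S0 : S' 0.
  by split=> //; split; rewrite ?in_itv /= ?lexx // subrr normr0 mulr0 add0r mulr_ge0.
have S'ub : ubound S' x by move=> y [].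
have hs : has_sup S' by split; [exists 0|exists x].
pose c := sup S'.
have c0 : 0 <= c by apply: ub_le_sup => //; exists x.
have cx : c <= x by apply: ge_sup => //; exists 0.
have cT : `[0, T]%classic c by rewrite /= in_itv /= c0 (le_trans cx).
have Sc : `|f c - f 0| <= e * c + L * m c.
  apply/ler_addgt0Pl => d d0.
  have d1 : 0 < d / (L + 1) by rewrite divr_gt0 //; lra.
  have [y [yx [yT Py]] cy] := sup_adherent d1 hs; rewrite -/c in cy.
  have yc : y <= c by apply: ub_le_sup; [exists x|].
  have := fL c y cT yT; rewrite [`|c - y|]ger0_norm ?subr_ge0 // => fcy.
  have tri : `|f c - f 0| <= `|f c - f y| + `|f y - f 0|.
    exact: ler_distD.
  have h1 : L * (c - y) <= d.
    have : c - y <= d / (L + 1) by lra.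
    move/(ler_wpM2l L0)/le_trans; apply.
    rewrite mulrA ler_pdivrMr; last lra.
    by rewrite mulrC ler_pM2l //; lra.
  have h2 : e * y <= e * c by rewrite ler_pM2l.
  have h3 : L * m y <= L * m c by rewrite ler_wpM2l // m_mono.
  by lra.
move: cx; rewrite le_eqVlt => /orP[/eqP <- //|cx].
exfalso.
(* If [c] lies in [U], the growth of [m] pays for the increment of [f]; otherwise the derivative at
   [c] is 0 and [f] varies at rate at most [e] near [c]. *)
have [d d0 Pd] : exists2 d, 0 < d & forall y, c < y -> y < c + d -> y <= x ->
    `|f y - f 0| <= e * y + L * m y.
  have [Uc|nUc] := pselect (U c).
    have [d /= d0 Ud] : \forall y \near c, U y by exact: open_nbhs_nbhs.
    exists d => // y cy yd yx.
    have yT : `[0, T]%classic y by rewrite /= in_itv /=; lra.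
    have := fL y c yT cT; rewrite [`|y - c|]ger0_norm; last lra.
    move=> fcy.
    have tri : `|f y - f 0| <= `|f y - f c| + `|f c - f 0|.
      exact: ler_distD.
    have /(m_jump _ _ c0 (ltW cy))/(ler_wpM2l L0) : `]c, y]%classic `<=` U.
      move=> z /=; rewrite in_itv /= => /andP[cz zy]; apply: Ud => /=.
      by rewrite ltr0_norm ?subr_lt0 //; lra.
    have : e * c <= e * y by rewrite ler_pM2l // ltW.
    by lra.
  have : is_derive c 1 f 0 by apply: contrapT => /= h; apply/nUc/BU/fB => /(_ cT).
  case=> df dv.
  move: df => /cvg_ex[l /= dl].
  have l0 : l = 0 by rewrite -dv; apply/esym/cvg_lim => //.
  rewrite {}l0 in dl.
  move/cvgrPdist_le: dl => /(_ e e0) [d /= d0 dP].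
  exists d => // y cy yd yx.
  have yc0 : y - c != 0 by rewrite subr_eq0 gt_eqF.
  have := dP (y - c); rewrite /= !sub0r !normrN normrZ normfV.
  rewrite [`|y - c|]gtr0_norm ?subr_gt0 // [(y - c)%:A]mulr1 subrK.
  move=> h; have {}h : `|f y - f c| <= e * (y - c).
    have /h/(_ yc0) : y - c < d by lra.
    by rewrite mulrC ler_pdivrMr ?subr_gt0.
  have tri : `|f y - f 0| <= `|f y - f c| + `|f c - f 0|.
    exact: ler_distD.
  have : L * m c <= L * m y by rewrite ler_wpM2l // m_mono // ltW.
  by lra.
pose y := Num.min x (c + d / 2).
have cy : c < y by rewrite lt_min cx /=; lra.
have yx : y <= x by rewrite ge_min lexx.
have yd : y < c + d by rewrite gt_min; apply/orP; right; lra.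
have : y <= c.
  apply: ub_le_sup; first by exists x.
  by split=> //; split; [rewrite in_itv /=; lra|exact: Pd].
by rewrite leNgt cy.
Qed.

(** The right-hand side is a measure in [A] that agrees with Lebesgue measure on the intervals []a,
    b]], hence everywhere. *)
Lemma lebesgue_measure_affine (R : realType) (k s : R) (A : set (measurableTypeR R)) :
  k != 0 -> measurable A ->
  @lebesgue_measure R A =
    (`|k|%:E * @lebesgue_measure R ((fun x : R => (k * x + s)%R) @^-1` A))%E.
Proof.
move=> k0 mA; pose h (x : measurableTypeR R) : measurableTypeR R := k * x + s.
have mh : measurable_fun [set: measurableTypeR R] h.
  by apply: measurable_funD => //; exact: measurable_funM.
pose nu : {measure set (measurableTypeR R) -> \bar R} :=
  mscale (NngNum (normr_ge0 k))
    (measure_function_pushforward__canonical__measure_function_Measure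
       (@lebesgue_measure R) mh).
rewrite (@lebesgue_measure_unique _ nu) // => _ [[a b] _ <-].
rewrite /nu /= /mscale /= /pushforward.
have [kp|kn] : 0 < k \/ k < 0 by case: ltgtP k0; auto.
  have -> : h @^-1` `]a, b]%classic = `](a - s) / k, (b - s) / k]%classic.
    apply/seteqP; split=> x /=; rewrite !in_itv /= /h ltr_pdivrMr // ler_pdivlMr //;
      by move=> /andP[? ?]; apply/andP; split; lra.
  rewrite !lebesgue_measure_itv /= !lte_fin ltr_pM2r ?invr_gt0 // ltrD2r.
  case: ifP => _; last by rewrite mule0.
  rewrite -!EFinB -EFinM gtr0_norm //; congr EFin; field.
  by rewrite gt_eqF.
have -> : h @^-1` `]a, b]%classic = `[(b - s) / k, (a - s) / k[%classic.
  apply/seteqP; split=> x /=; rewrite !in_itv /= /h ltr_ndivlMr // ler_ndivrMr //;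
    by move=> /andP[? ?]; apply/andP; split; lra.
rewrite !lebesgue_measure_itv /= !lte_fin ltr_nM2r ?invr_lt0 // ltrD2r.
case: ifP => _; last by rewrite mule0.
rewrite -!EFinB -EFinM ltr0_norm //; congr EFin; field.
by rewrite lt_eqF.
Qed.

Lemma ae_affine (R : realType) (k s : R) (P : R -> Prop) : k != 0 ->
  {ae @lebesgue_measure R, forall x, P x} ->
  {ae @lebesgue_measure R, forall x, P (k * x + s)}.
Proof.
move=> k0 [B [mB B0 PB]].
exists ((fun x : R => k * x + s) @^-1` B); split.
- rewrite -[X in measurable X]setTI.
  suff : measurable_fun [set: R] (fun x : R => k * x + s) by apply.
  by apply: measurable_funD => //; exact: measurable_funM.
- have := lebesgue_measure_affine s k0 mB; rewrite B0 => /esym/eqP.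
  by rewrite mule_eq0 eqe normr_eq0 (negbTE k0) /= => /eqP.
- by move=> x nP; apply: PB.
Qed.

Lemma ae_neq (R : realType) (c : R) : {ae @lebesgue_measure R, forall x, x != c}.
Proof.
exists [set c]; split; [exact: measurable_set1|exact: lebesgue_measure_set1|].
by move=> x /= /negP; rewrite negbK => /eqP.
Qed.

Lemma lipschitz_measurable (R : realType) (T : R) (f : R -> R) :
  [lipschitz f x | x in `[0, T]] -> measurable_fun `[0, T] f.
Proof.
move=> /lipschitzP[L L0 fL]; apply: subspace_continuous_measurable_fun => //.
apply/subspace_continuousP => x xT; apply/cvgrPdist_le => e e0.
have L1 : 0 < L + 1 by lra.
near=> y.
have yT : `[0, T]%classic y by near: y; exact: withinT.
apply: le_trans (fL _ _ xT yT) _.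
apply: (@le_trans _ _ ((L + 1) * `|x - y|)).
  by rewrite ler_wpM2r // lerDl.
rewrite mulrC -ler_pdivlMr //; near: y.
have : \forall y \near x, `|x - y| <= e / (L + 1).
  have /cvgrPdist_le : id @ x --> x by exact: cvg_id.
  by apply; exact: divr_gt0.
by apply: filterS => z h _.
Unshelve. all: by end_near. Qed.

Lemma lipschitz_bounded (R : realType) (T : R) (f : R -> R) : 0 <= T ->
  [lipschitz f x | x in `[0, T]] ->
  exists2 M, 0 <= M & forall x, `[0, T]%classic x -> `|f x| <= M.
Proof.
move=> T0 /lipschitzP[L L0 fL]; exists (`|f 0| + L * T).
  by rewrite addr_ge0 ?mulr_ge0.
move=> x xT; have T00 : `[0, T]%classic 0 by rewrite /= in_itv /= lexx.
have -> : f x = f 0 + (f x - f 0) by rewrite addrC subrK.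
apply: le_trans (ler_normD _ _) _; rewrite lerD2l.
apply: le_trans (fL _ _ xT T00) _; rewrite subr0 ler_wpM2l //.
by move: xT; rewrite /= in_itv /= => /andP[x0 xT]; rewrite ger0_norm.
Qed.

Section ae.
Context {R : realType}.
Implicit Types P Q : R -> Prop.

Let aeF := ae_filter_ringOfSetsType (@lebesgue_measure R).

Lemma aeS P Q : (forall x, P x -> Q x) ->
  {ae @lebesgue_measure R, forall x, P x} -> {ae @lebesgue_measure R, forall x, Q x}.
Proof. move=> PQ; exact: (@filterS _ _ aeF). Qed.

Lemma aeI P Q : {ae @lebesgue_measure R, forall x, P x} ->
  {ae @lebesgue_measure R, forall x, Q x} ->
  {ae @lebesgue_measure R, forall x, P x /\ Q x}.
Proof. exact: (@filterI _ _ aeF). Qed.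
End ae.

(** Lebesgue's notion of primitive for bounded integrands. Identities between iterated integrals
    then follow by comparing derivatives and values at 0. *)
Definition rprimitive (R : realType) (T : R) (f g : R -> R) :=
  [lipschitz f x | x in `[0, T]] /\
  {ae @lebesgue_measure R, forall x, `[0, T]%classic x -> is_derive x 1 f (g x)}.

Lemma eq_rprimitive (R : realType) (T : R) (f f' g g' : R -> R) :
  {in `[0, T], f =1 f'} ->
  {ae @lebesgue_measure R, forall x, `[0, T]%classic x -> g x = g' x} ->
  rprimitive T f g -> rprimitive T f' g'.
Proof.
move=> ff' gg' [/lipschitzP[L L0 fL] df]; split.
  by apply/lipschitzP; exists L => // x y xT yT; rewrite -!ff' //; exact: fL.
(* Derivatives are two-sided on the real line while [f] and [f'] agree only on [[0, T]], so the two
   endpoints are discarded. *)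
apply: aeS (aeI (aeI df gg') (aeI (ae_neq 0) (ae_neq T))).
move=> x /= [[{}df {}gg'] [xN0 xNT]] xT.
rewrite -gg' //; apply: near_eq_is_derive (df xT).
move: (xT); rewrite /= in_itv /= !le_eqVlt [0 == x]eq_sym (negPf xN0) (negPf xNT) /= => xT'.
near=> y; apply: ff'; apply: subset_itv_oo_cc; near: y.
by apply: near_in_itvoo; rewrite in_itv /=.
Unshelve. all: by end_near. Qed.

Lemma rprimitive_cst (R : realType) (T c : R) : rprimitive T (cst c) (cst 0).
Proof.
split; last by apply: aeW => x _; exact: is_derive_cst.
by apply/lipschitzP; exists 0 => // x y _ _; rewrite subrr normr0 mul0r.
Qed.

Lemma rprimitiveD (R : realType) (T : R) (f f' g g' : R -> R) :
  rprimitive T f g -> rprimitive T f' g' -> rprimitive T (f \+ f') (g \+ g').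
Proof.
move=> [/lipschitzP[L L0 fL] df] [/lipschitzP[L' L'0 fL'] df']; split.
  apply/lipschitzP; exists (L + L') => [|x y xT yT]; first exact: addr_ge0.
  rewrite /= opprD addrACA mulrDl; apply: le_trans (ler_normD _ _) _.
  by rewrite lerD // ?fL ?fL'.
apply: aeS (aeI df df') => x /= [{}df {}df'] xT.
by have := is_deriveD (df xT) (df' xT).
Qed.

Lemma rprimitiveM (R : realType) (T : R) (f f' g g' : R -> R) : 0 <= T ->
  rprimitive T f g -> rprimitive T f' g' ->
  rprimitive T (f \* f') (fun x => g x * f' x + f x * g' x).
Proof.
move=> T0 [lf df] [lf' df']; split.
  have [M M0 fM] := lipschitz_bounded T0 lf.
  have [M' M'0 fM'] := lipschitz_bounded T0 lf'.
  move: lf lf' => /lipschitzP[L L0 fL] /lipschitzP[L' L'0 fL'].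
  apply/lipschitzP; exists (M * L' + M' * L) => [|x y xT yT].
    by rewrite addr_ge0 ?mulr_ge0.
  have -> : (f \* f') x - (f \* f') y = f x * (f' x - f' y) + f' y * (f x - f y).
    by rewrite /=; ring.
  rewrite mulrDl -!mulrA; apply: le_trans (ler_normD _ _) _; rewrite !normrM.
  by rewrite lerD // ler_pM // ?fM ?fM' ?fL ?fL'.
apply: aeS (aeI df df') => x /= [{}df {}df'] xT.
have := is_deriveM (df xT) (df' xT); congr (is_derive _ _ _ _).
by rewrite /GRing.scale /= addrC mulrC.
Qed.

Lemma rprimitive_affine (R : realType) (T k s : R) (f g : R -> R) : k != 0 ->
  (forall x, x \in `[0, T] -> k * x + s \in `[0, T]) ->
  rprimitive T f g ->
  rprimitive T (fun x => f (k * x + s)) (fun x => k * g (k * x + s)).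
Proof.
move=> k0 ksT [/lipschitzP[L L0 fL] df]; split.
  apply/lipschitzP; exists (L * `|k|) => [|x y xT yT]; first by rewrite mulr_ge0.
  apply: le_trans (fL _ _ (ksT _ xT) (ksT _ yT)) _.
  by rewrite opprD addrACA subrr addr0 -mulrBr normrM mulrA.
apply: aeS (ae_affine s k0 df) => x dfx xT.
have h : is_derive x 1 (fun x : R => k * x + s) k.
  have -> : (fun x : R => k * x + s) = (k \*: id) + cst s by [].
  apply: is_derive_eq; by rewrite addr0 /GRing.scale /= mulr1.
rewrite mulrC; exact: (@is_derive1_comp _ f (fun y => k * y + s)) (dfx (ksT _ xT)) h.
Qed.

(** The difference is Lipschitz with derivative 0 almost everywhere, hence constant. *)
Lemma rprimitive_eq (R : realType) (T : R) (f f' g : R -> R) :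
  rprimitive T f g -> rprimitive T f' g -> f 0 = f' 0 ->
  {in `[0, T], f =1 f'}.
Proof.
move=> fg f'g ff' x xT; apply/eqP; rewrite -subr_eq0; apply/eqP.
have : rprimitive T (f \+ (fun y => - f' y)) (cst 0).
  move: f'g => [/lipschitzP[L L0 fL] df'].
  have /(rprimitiveD fg) : rprimitive T (fun y => - f' y) (fun y => - g y).
    split.
      by apply/lipschitzP; exists L => // y z yT zT; rewrite -opprD normrN fL.
    by apply: aeS df' => y df' yT; have := is_deriveN (df' yT).
  by apply: eq_rprimitive => //; apply: aeW => y _; rewrite /= subrr.
move=> [lf df]; have := lipschitz_ae_derive0 lf df xT.
by rewrite /= ff' subrr.
Qed.

(** * Primitives of bounded measurable functions *)

Section integral.
Context (R : realType) (T M : R) (g : R -> R).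
Hypothesis T_ge0 : 0 <= T.
Hypothesis mg : measurable_fun `[0, T] g.
Hypothesis gM : {ae @lebesgue_measure R, forall x, `[0, T]%classic x -> `|g x| <= M}.

Local Notation mu := (@lebesgue_measure R).

Lemma ae_bounded_integrable : mu.-integrable `[0, T] (EFin \o g).
Proof.
apply/integrableP; split; first exact/measurable_EFinP.
apply: (@le_lt_trans _ _ (\int[mu]_(x in `[0%R, T]) (cst `|M|%:E) x)%E).
  apply: ae_ge0_le_integral => //.
  - by apply: measurableT_comp => //; exact/measurable_EFinP.
  - by move=> x _; rewrite lee_fin.
  - apply: aeS gM => x gMx xT.
    by rewrite /= lee_fin (le_trans (gMx xT)) ?ler_norm.
rewrite integral_cst //= lebesgue_measure_itv /= lte_fin.
by case: ifP => _; rewrite ?mule0 // -EFinB -EFinM ltry.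
Qed.

Lemma ae_bounded_integral_le (a b : R) : 0 <= a -> a <= b -> b <= T ->
  `|\int[mu]_(x in `]a, b]) g x| <= `|M| * (b - a).
Proof.
move=> a0 ab bT.
have abT : `]a, b] `<=` `[0, T].
  by move=> x /=; rewrite !in_itv /= => /andP[? ?]; apply/andP; split; lra.
have ig : mu.-integrable `]a, b] (EFin \o g).
  by apply: integrableS ae_bounded_integrable.
apply: le_trans (le_normr_Rintegral _ ig) _ => //.
have mab : mu `]a, b]%classic = (b - a)%:E.
  rewrite [LHS]lebesgue_measure_itv /= lte_fin; case: ltgtP ab => // -> _.
  by rewrite subrr.
have -> : `|M| * (b - a) = \int[mu]_(x in `]a, b]) `|M|.
  by rewrite Rintegral_cst //; congr (_ * _); exact: (esym (congr1 fine mab)).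
rewrite /Rintegral fine_le //.
- by apply: integrable_fin_num => //; exact: integrable_norm.
- rewrite integral_cst //= (_ : lebesgue_measure _ = (b - a)%:E) //.
apply: ae_ge0_le_integral => //.
- by apply/measurable_EFinP; apply: measurableT_comp => //; apply: measurable_funS mg.
- apply: aeS gM => x gMx /abT xT.
  by rewrite /= lee_fin (le_trans (gMx xT)) ?ler_norm.
Qed.

(** The essential bound on [g] gives the Lipschitz constant [|M|]; Lebesgue's differentiation
    theorem gives the derivative at almost every point. *)
Lemma rprimitive_integral : rprimitive T (fun x => \int[mu]_(t in `[0, x]) g t) g.
Proof.
split.
  apply/lipschitzP; exists `|M| => // x y.
  have H u v : 0 <= u -> u <= v -> v <= T ->
      `|\int[mu]_(t in `[0, v]) g t - \int[mu]_(t in `[0, u]) g t| <= `|M| * (v - u).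
    move=> u0 uv vT; rewrite Rintegral_itvB ?bnd_simp //.
      exact: ae_bounded_integral_le.
    apply: integrableS ae_bounded_integrable => //.
    by apply: subset_itvl; rewrite bnd_simp.
  rewrite /= !in_itv /= => /andP[x0 xT] /andP[y0 yT].
  have [xy|yx] := leP x y.
    by rewrite distrC [`|x - y|]distrC [`|y - x|]ger0_norm ?subr_ge0 // H.
  by rewrite [`|x - y|]ger0_norm ?subr_ge0 ?H // ltW.
(* Extension of [g] by 0 to the whole line, where Lebesgue points are considered; integrals over
   [[0, x]] are unchanged for [x <= T]. *)
pose h := g \_ `[0, T]%classic.
have hE (x : R) : x <= T ->
    \int[mu]_(t in `[0, x]) h t = \int[mu]_(t in `[0, x]) g t.
  move=> xT; apply: eq_Rintegral => t /set_mem /=; rewrite in_itv /= => /andP[t0 tx].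
  by rewrite /h patchE mem_set //= in_itv /= t0 (le_trans tx).
have := lebesgue_differentiation (integrable_locally _ ae_bounded_integrable).
move=> /(_ (measurable_itv _)) lpt.
apply: aeS (aeI lpt (aeI (ae_neq 0) (ae_neq T))) => x /= [{}lpt [xN0 xNT]] xT.
move: (xT); rewrite in_itv /= !le_eqVlt [0 == x]eq_sym (negPf xN0) (negPf xNT) /=.
move=> /andP[x0 xT'].
have ih : mu.-integrable `[0, T] (EFin \o h).
  apply: eq_integrable ae_bounded_integrable => // t tT.
  by rewrite /= /h patchE tT.
have [|dh hx] := FTC1_lebesgue_pt xT' ih _ lpt; first by rewrite /= lte_fin.
suff : is_derive x 1 (fun y : R => \int[mu]_(t in `[0, y]) h t) (g x).
  apply: near_eq_is_derive.
  near=> y; apply: hE; apply: ltW; near: y; exact: lt_nbhsl.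
apply: DeriveDef => //; rewrite -derive1E hx /h patchE mem_set.
Unshelve. all: by end_near. Qed.

Lemma rprimitive_integral_right :
  rprimitive T (fun x => \int[mu]_(t in `[x, T]) g t) (fun x => - g x).
Proof.
have [lF dF] := rprimitive_integral.
have FE x : x \in `[0, T] -> \int[mu]_(t in `[0, T]) g t -
    \int[mu]_(t in `[0, x]) g t = \int[mu]_(t in `[x, T]) g t.
  rewrite in_itv /= => /andP[x0 xT].
  rewrite Rintegral_itvB ?bnd_simp //; last exact: ae_bounded_integrable.
  apply: Rintegral_itv_obnd_cbnd; apply: integrableS ae_bounded_integrable => //.
  by move=> t /=; rewrite !in_itv /= => /andP[xt ->]; rewrite (le_trans x0 (ltW xt)).
apply: (@eq_rprimitive _ _ (cst (\int[mu]_(t in `[0, T]) g t) \+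
  (fun x => -1 * \int[mu]_(t in `[0, x]) g t)) _ (fun x => -1 * g x)).
- by move=> x /FE <-; rewrite /= mulN1r.
- by apply: aeW => x _; rewrite mulN1r.
apply: (@eq_rprimitive _ _ _ _ (cst 0 \+ (fun x => 0 * (\int[mu]_(t in `[0, x]) g t)
   + -1 * g x))).
- by [].
- by apply: aeW => x _; rewrite /= mul0r !add0r.
apply: rprimitiveD; first exact: rprimitive_cst.
by apply: (rprimitiveM T_ge0 (rprimitive_cst T (-1))); exact: rprimitive_integral.
Qed.

End integral.

(** * Complex-valued functions *)

Section cplx.
Context {R : realType}.
Implicit Types x y : Cplx R.
Local Notation Re := (@complex.Re R).
Local Notation Im := (@complex.Im R).

Lemma cplx_eqP x y : Re x = Re y -> Im x = Im y -> x = y.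
Proof. by case: x y => [a b] [c d] /= -> ->. Qed.

Lemma cplxReD x y : Re (x + y) = Re x + Re y.
Proof. by case: x y => [a b] [c d]. Qed.
Lemma cplxImD x y : Im (x + y) = Im x + Im y.
Proof. by case: x y => [a b] [c d]. Qed.
Lemma cplxReN x : Re (- x) = - Re x.
Proof. by case: x => [a b]. Qed.
Lemma cplxImN x : Im (- x) = - Im x.
Proof. by case: x => [a b]. Qed.
Lemma cplxReM x y : Re (x * y) = Re x * Re y - Im x * Im y.
Proof. by case: x y => [a b] [c d]. Qed.
Lemma cplxImM x y : Im (x * y) = Re x * Im y + Im x * Re y.
Proof. by case: x y => [a b] [c d]. Qed.

Lemma normr_Re_le x : `|Re x| <= Normc.normc x.
Proof.
case: x => a b /=; rewrite -sqrtr_sqr ler_wsqrtr //.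
by rewrite lerDl sqr_ge0.
Qed.

Lemma normr_Im_le x : `|Im x| <= Normc.normc x.
Proof.
case: x => a b /=; rewrite -sqrtr_sqr ler_wsqrtr //.
by rewrite lerDr sqr_ge0.
Qed.

Lemma normc_le x : Normc.normc x <= `|Re x| + `|Im x|.
Proof.
case: x => a b /=.
rewrite -[leRHS]ger0_norm ?addr_ge0 // -sqrtr_sqr ler_wsqrtr //.
by rewrite sqrrD !real_normK ?num_real // lerD2r lerDl mulrn_wge0 ?mulr_ge0.
Qed.
Lemma normc_ge0 x : 0 <= Normc.normc x.
Proof. exact: le_trans (normr_ge0 _) (normr_Re_le x). Qed.
End cplx.

Definition cprimitive (R : realType) (T : R) (f g : R -> Cplx R) :=
  rprimitive T (fun x => complex.Re (f x)) (fun x => complex.Re (g x)) /\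
  rprimitive T (fun x => complex.Im (f x)) (fun x => complex.Im (g x)).

Section cprimitive.
Context (R : realType) (T : R).
Implicit Types f g : R -> Cplx R.

Lemma eq_cprimitive f f' g g' :
  {in `[0, T], f =1 f'} ->
  {ae @lebesgue_measure R, forall x, `[0, T]%classic x -> g x = g' x} ->
  cprimitive T f g -> cprimitive T f' g'.
Proof.
move=> ff' gg' [hR hI]; split.
- apply: eq_rprimitive hR => [x /ff' -> //|].
  by apply: aeS gg' => x gg' /gg' ->.
- apply: eq_rprimitive hI => [x /ff' -> //|].
  by apply: aeS gg' => x gg' /gg' ->.
Qed.

Lemma cprimitive_cst (c : Cplx R) : cprimitive T (cst c) (cst 0).
Proof. by split; exact: rprimitive_cst. Qed.

Lemma cprimitiveD f f' g g' :
  cprimitive T f g -> cprimitive T f' g' -> cprimitive T (f \+ f') (g \+ g').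
Proof.
move=> [hR hI] [hR' hI']; split.
- apply: (eq_rprimitive _ _ (rprimitiveD hR hR')) => [x _|].
    by rewrite /= cplxReD.
  by apply: aeW => x _ /=; rewrite cplxReD.
- apply: (eq_rprimitive _ _ (rprimitiveD hI hI')) => [x _|].
    by rewrite /= cplxImD.
  by apply: aeW => x _ /=; rewrite cplxImD.
Qed.

Lemma cprimitiveM f f' g g' : 0 <= T ->
  cprimitive T f g -> cprimitive T f' g' ->
  cprimitive T (f \* f') (fun x => g x * f' x + f x * g' x).
Proof.
move=> T0 [hR hI] [hR' hI']; have N u v : rprimitive T u v ->
    rprimitive T (fun x => - u x) (fun x => - v x).
  move=> uv; apply: (eq_rprimitive _ _ (rprimitiveM T0 (rprimitive_cst T (-1)) uv)).
    by move=> x _ /=; rewrite mulN1r.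
  by apply: aeW => x _ /=; rewrite mul0r add0r mulN1r.
split.
- apply: (eq_rprimitive _ _
    (rprimitiveD (rprimitiveM T0 hR hR') (N _ _ (rprimitiveM T0 hI hI')))).
    by move=> x _; rewrite /= cplxReM.
  by apply: aeW => x _ /=; rewrite cplxReD !cplxReM; ring.
- apply: (eq_rprimitive _ _
    (rprimitiveD (rprimitiveM T0 hR hI') (rprimitiveM T0 hI hR'))).
    by move=> x _; rewrite /= cplxImM.
  by apply: aeW => x _ /=; rewrite cplxImD !cplxImM; ring.
Qed.

Lemma cprimitiveZ (c : Cplx R) f g : 0 <= T ->
  cprimitive T f g -> cprimitive T (fun x => c * f x) (fun x => c * g x).
Proof.
move=> T0 fg; apply: (eq_cprimitive _ _ (cprimitiveM T0 (cprimitive_cst c) fg)) => //.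
by apply: aeW => x _ /=; rewrite mul0r add0r.
Qed.

Lemma cprimitive_sum I (r : seq I) (P : pred I) (f g : I -> R -> Cplx R) :
  (forall i, P i -> cprimitive T (f i) (g i)) ->
  cprimitive T (fun x => \sum_(i <- r | P i) f i x)
               (fun x => \sum_(i <- r | P i) g i x).
Proof.
move=> fg; elim: r => [|i r IHr].
  apply: (eq_cprimitive _ _ (cprimitive_cst 0)) => [x _|].
    by rewrite big_nil.
  by apply: aeW => x _; rewrite big_nil.
case Pi : (P i); last first.
  apply: (eq_cprimitive _ _ IHr) => [x _|]; first by rewrite big_cons Pi.
  by apply: aeW => x _; rewrite big_cons Pi.
apply: (eq_cprimitive _ _ (cprimitiveD (fg _ Pi) IHr)) => [x _|].
  by rewrite big_cons Pi.
by apply: aeW => x _; rewrite big_cons Pi.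
Qed.

Lemma cprimitive_affine (k s : R) f g : k != 0 ->
  (forall x, x \in `[0, T] -> k * x + s \in `[0, T]) -> cprimitive T f g ->
  cprimitive T (fun x => f (k * x + s)) (fun x => (k%:C)%C * g (k * x + s)).
Proof.
move=> k0 ksT [hR hI]; split.
- apply: (eq_rprimitive _ _ (rprimitive_affine k0 ksT hR)) => //.
  by apply: aeW => x _; rewrite cplxReM /= mul0r subr0.
- apply: (eq_rprimitive _ _ (rprimitive_affine k0 ksT hI)) => //.
  by apply: aeW => x _; rewrite cplxImM /= mul0r addr0.
Qed.

Lemma cprimitive_eq f f' g : cprimitive T f g -> cprimitive T f' g ->
  f 0 = f' 0 -> {in `[0, T], f =1 f'}.
Proof.
move=> [hR hI] [hR' hI'] ff' x xT; apply: cplx_eqP.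
- by apply: (rprimitive_eq hR hR') => //; rewrite ff'.
- by apply: (rprimitive_eq hI hI') => //; rewrite ff'.
Qed.

Lemma cprimitive_Linfty f g : 0 <= T -> cprimitive T f g -> Linfty T f.
Proof.
move=> T0 [[hR _] [hI _]]; split; try exact: lipschitz_measurable.
have [M _ fM] := lipschitz_bounded T0 hR.
have [N _ fN] := lipschitz_bounded T0 hI.
exists (M + N); apply: aeW => x xT; apply: le_trans (normc_le _) _.
by rewrite lerD ?fM ?fN.
Qed.

Lemma LinftyM f g : Linfty T f -> Linfty T g -> Linfty T (f \* g).
Proof.
move=> [mfR mfI [M fM]] [mgR mgI [N gN]]; split.
- rewrite (_ : (fun x => _) = (fun x => complex.Re (f x) * complex.Re (g x)
      - complex.Im (f x) * complex.Im (g x))); last by apply/funext => x; rewrite cplxReM.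
  by apply: measurable_funB; exact: measurable_funM.
- rewrite (_ : (fun x => _) = (fun x => complex.Re (f x) * complex.Im (g x)
      + complex.Im (f x) * complex.Re (g x))); last by apply/funext => x; rewrite cplxImM.
  by apply: measurable_funD; exact: measurable_funM.
- exists (M * N); apply: aeS (aeI fM gN) => x /= [{}fM {}gN] xT.
  by rewrite Normc.normcM ler_pM ?fM ?gN // normc_ge0.
Qed.

Lemma Linfty_bound f : Linfty T f -> exists M : R,
  {ae @lebesgue_measure R, forall x, `[0, T]%classic x -> `|complex.Re (f x)| <= M} /\
  {ae @lebesgue_measure R, forall x, `[0, T]%classic x -> `|complex.Im (f x)| <= M}.
Proof.
move=> [_ _ [M fM]]; exists M; split; apply: aeS fM => x fM /fM; apply: le_trans.
- exact: normr_Re_le.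
- exact: normr_Im_le.
Qed.

Lemma cprimitive_integral f : Linfty T f ->
  cprimitive T (fun x => cintegral `[0, x] f) f.
Proof.
move=> Tf; have [M [fR fI]] := Linfty_bound Tf; case: Tf => mR mI _.
by split; [exact: rprimitive_integral mR fR|exact: rprimitive_integral mI fI].
Qed.

Lemma cprimitive_integral_right f : 0 <= T -> Linfty T f ->
  cprimitive T (fun x => cintegral `[x, T] f) (fun x => - f x).
Proof.
move=> T0 Tf; have [M [fR fI]] := Linfty_bound Tf; case: Tf => mR mI _.
split.
- apply: (eq_rprimitive _ _ (rprimitive_integral_right T0 mR fR)) => //.
  by apply: aeW => x _; rewrite cplxReN.
- apply: (eq_rprimitive _ _ (rprimitive_integral_right T0 mI fI)) => //.
  by apply: aeW => x _; rewrite cplxImN.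
Qed.

Lemma cintegral_itv_pt f (x : R) : cintegral `[x, x] f = 0.
Proof. by rewrite /cintegral set_itv1 !Rintegral_set1. Qed.

End cprimitive.

(** * Flows and the group of paths *)

Lemma grp_coef_inj (R : realType) (g h : grp R) :
  (forall w, coef w g = coef w h) -> g = h.
Proof. by move=> gh; apply: val_inj; apply: funext => w; exact: gh. Qed.

Lemma grp_coef_nil (R : realType) (g : grp R) : coef [::] g = 1.
Proof. exact/eqP/grp_valP. Qed.

Lemma grp_coefM_cons (R : realType) (g h : grp R) i w :
  coef (i :: w) (g * h)%g = coef (i :: w) h +
    \sum_(k < (size w).+1) coef (i :: take k w) g * coef (drop k w) h.
Proof.
by rewrite -[LHS]/(smul g h (i :: w)) smul_cons (eqP (grp_valP g)) mul1r.
Qed.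

Lemma grp_coefM (R : realType) (g h : grp R) w : coef w (g * h)%g =
    \sum_(k < (size w).+1) coef (take k w) g * coef (drop k w) h.
Proof. by []. Qed.

Lemma grp_coef1 (R : realType) w : coef w (1%g : grp R) = (w == [::])%:R.
Proof. by []. Qed.

Lemma velocityM (R : realType) (a : nat -> R -> Cplx R) x (f : ncseries R) i w :
  (velocity a x * f) (i :: w) = a i x * f w.
Proof.
rewrite -[LHS]/(smul _ _ _) smul_cons /= mul0r add0r /smul big_ord_recl /=.
rewrite take0 drop0 big1 ?addr0 // => -[k /= kw] _.
by case: w kw => [|j w] //= _; rewrite mul0r.
Qed.

Lemma velocityM_nil (R : realType) (a : nat -> R -> Cplx R) x (f : ncseries R) :
  (velocity a x * f) [::] = 0.
Proof. by rewrite -[LHS]/(smul _ _ _) smul_nil mul0r. Qed.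

Lemma ae_forall_word (R : realType) (P : word -> R -> Prop) :
  (forall w, {ae @lebesgue_measure R, forall x, P w x}) ->
  {ae @lebesgue_measure R, forall x, forall w, P w x}.
Proof.
(* There are countably many words. The decoding [unpickle] is partial, so codes of no word receive a
   trivial statement. *)
move=> aeP; pose Q (o : option word) x := if o is Some w then P w x else True.
have aeQ o : {ae @lebesgue_measure R, forall x, Q o x}.
  by case: o => [w|]; [exact: aeP|exact: aeW].
apply: aeS (ae_foralln (fun n => aeQ (unpickle n))) => x Qx w.
by have := Qx (pickle w); rewrite pickleK.
Qed.

(** Multiplying by the velocity on the left adds one letter in front, so the flow equation is a
    triangular system: each coefficient is a primitive built from the coefficient of a shorter word,
    starting from the constant 1 at the empty word. *)
Lemma is_flowP (R : realType) (T : R) (a : nat -> R -> Cplx R) (F : R -> grp R) :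
  is_flow T a F <-> F 0 = 1%g /\ forall i w,
    cprimitive T (fun x => coef (i :: w) (F x)) (fun x => a i x * coef w (F x)).
Proof.
split=> [[F0 lF dF]|[F0 dF]].
  split=> // i w; split; split; try by have [] := lF (i :: w).
  - apply: aeS dF => x dF xT; have [+ _] := dF xT (i :: w).
    by rewrite velocityM.
  - apply: aeS dF => x dF xT; have [_ +] := dF xT (i :: w).
    by rewrite velocityM.
have {}dF w : cprimitive T (fun x => coef w (F x))
    (fun x => (velocity a x * grp_val (F x)) w).
  case: w => [|i w].
    apply: (eq_cprimitive _ _ (cprimitive_cst _ 1)) => [x _|].
      by rewrite grp_coef_nil.
    by apply: aeW => x _; rewrite velocityM_nil.
  apply: (eq_cprimitive _ _ (dF i w)) => //.
  by apply: aeW => x _; rewrite velocityM.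
split=> // [w|].
  by have [[? _] [? _]] := dF w.
suff : {ae @lebesgue_measure R, forall x, forall w, time_interval T x ->
    is_derive x 1 (fun y => complex.Re (coef w (F y)))
          (complex.Re ((velocity a x * grp_val (F x)) w)) /\
    is_derive x 1 (fun y => complex.Im (coef w (F y)))
          (complex.Im ((velocity a x * grp_val (F x)) w))}.
  by apply: aeS => x h xT w; exact: h.
apply: ae_forall_word => w; have [[_ h] [_ h']] := dF w.
by apply: aeS (aeI h h') => x /= [{}h {}h'] xT; split; [exact: h|exact: h'].
Qed.

(** * Existence, uniqueness and reparametrisation of flows *)

Section flow.
Context (R : realType) (T : R).
Hypothesis T_gt0 : 0 < T.
Implicit Types a b : nat -> R -> Cplx R.

Let T_ge0 : 0 <= T := ltW T_gt0.

Lemma in_itvT : T \in `[0, T]. Proof. by rewrite in_itv /= lexx T_ge0. Qed.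

(** The bound on the roots becomes a geometric bound, which survives rescaling and bounds each
    component. *)
Lemma pathXP a : pathX T a <->
  (forall i, measurable_fun `[0, T] (fun x => complex.Re (a i x)) /\
             measurable_fun `[0, T] (fun x => complex.Im (a i x))) /\
  exists2 M : R, 0 <= M & forall i, {ae @lebesgue_measure R,
    forall x, `[0, T]%classic x -> Normc.normc (a i x) <= M ^+ i.+1}.
Proof.
split=> [[Ta [M aM]]|[ma [M M0 aM]]].
  split=> [i|]; first by have [] := Ta i.
  exists `|M| => // i; apply: aeS (aM i) => x {}aM xT.
  have := aM xT; set z := Normc.normc _ => zM.
  have z0 : 0 <= z by exact: normc_ge0.
  rewrite -[z]powRr1 // -(@mulVf _ i.+1%:R) ?pnatr_eq0 // powRrM.
  rewrite powR_mulrn ?powR_ge0 // lerXn2r ?nnegrE ?powR_ge0 //.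
  exact: le_trans zM (ler_norm _).
split=> [i|]; first by have [? ?] := ma i; split=> //; exists (M ^+ i.+1).
exists M => i; apply: aeS (aM i) => x {}aM xT.
apply: (@le_trans _ _ ((M ^+ i.+1) `^ (i.+1%:R^-1))).
  by rewrite ge0_ler_powR ?nnegrE ?invr_ge0 ?ler0n ?normc_ge0 ?exprn_ge0 ?aM.
by rewrite -powR_mulrn // -powRrM mulfV ?pnatr_eq0 // powRr1.
Qed.

Lemma is_flow_uniq a F F' : is_flow T a F -> is_flow T a F' ->
  {in `[0, T], F =1 F'}.
Proof.
move=> /is_flowP[F0 dF] /is_flowP[F'0 dF'] x xT.
apply: grp_coef_inj => w; elim: w x xT => [|i w IHw] x xT; first by rewrite !grp_coef_nil.
have h : cprimitive T (fun x => coef (i :: w) (F' x)) (fun x => a i x * coef w (F x)).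
  by apply: (eq_cprimitive _ _ (dF' i w)) => //; apply: aeW => y yT; rewrite IHw.
by apply: (cprimitive_eq (dF i w) h _ xT); rewrite F0 F'0.
Qed.

(** The endpoint is defined through a chosen flow; uniqueness on [[0, T]] lets any flow compute
    it. *)
Lemma endpointE a F : is_flow T a F -> endpoint T a = F T.
Proof.
move=> flF; rewrite /endpoint /flow.
by case: xgetP => [G _ flG|/(_ _ flF)//]; exact: (is_flow_uniq flG flF in_itvT).
Qed.

(** Solves the triangular system by repeated integration from 0. The first letter carries the latest
    time, whereas in [iterint] it carries the earliest. *)
Fixpoint picard a (w : word) (x : R) : Cplx R :=
  if w is i :: v then cintegral `[0, x] (fun u => a i u * picard a v u) else 1.

Lemma picard_cprimitive a i w : pathX T a ->
  cprimitive T (picard a (i :: w)) (fun x => a i x * picard a w x).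
Proof.
move=> [Ta _]; elim: w i => [|j w IHw] i;
  apply: cprimitive_integral; apply: LinftyM (Ta i) _.
- exact: cprimitive_Linfty T_ge0 (cprimitive_cst _ _).
- exact: cprimitive_Linfty T_ge0 (IHw j).
Qed.

Definition picard_flow a (x : R) : grp R :=
  @Grp R (fun w => picard a w x) (eqxx 1).

Lemma picard_is_flow a : pathX T a -> is_flow T a (picard_flow a).
Proof.
move=> Ta; apply/is_flowP; split; last by move=> i w; exact: picard_cprimitive.
apply: grp_coef_inj => -[|i w] //=.
by rewrite /coef /= cintegral_itv_pt.
Qed.

Lemma flow_is_flow a : pathX T a -> is_flow T a (flow T a).
Proof.
by move=> Ta; rewrite /flow; apply: xgetPex; exists (picard_flow a); exact: picard_is_flow.
Qed.

Lemma eq_is_flow a b F :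
  (forall i, {ae @lebesgue_measure R, forall x, `[0, T]%classic x -> a i x = b i x}) ->
  is_flow T a F -> is_flow T b F.
Proof.
move=> ab /is_flowP[F0 dF]; apply/is_flowP; split=> // i w.
by apply: (eq_cprimitive _ _ (dF i w)) => //; apply: aeS (ab i) => x h /h ->.
Qed.

(** The chain rule scales the velocity by [k]. The right factor restores the value 1 at 0 and
    preserves the equation, in which the velocity acts on the left. *)
Lemma is_flow_affine (k s : R) a F : k != 0 ->
  (forall x, x \in `[0, T] -> k * x + s \in `[0, T]) -> is_flow T a F ->
  is_flow T (fun i x => (k%:C)%C * a i (k * x + s))
    (fun x => F (k * x + s)%R * (F s)^-1)%g.
Proof.
move=> k0 ksT /is_flowP[F0 dF]; apply/is_flowP; split=> [|i w].
  by rewrite mulr0 add0r mulgV.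
have dk j v := cprimitive_affine k0 ksT (dF j v).
pose h : grp R := ((F s)^-1)%g.
have := cprimitiveD (cprimitive_cst T (coef (i :: w) h))
  (@cprimitive_sum R T _ (index_enum 'I_(size w).+1) predT _ _ (fun l _ =>
    cprimitiveZ (coef (drop l w) h) T_ge0 (dk i (take l w)))).
apply: eq_cprimitive => [x _|].
  by rewrite grp_coefM_cons /=; congr (_ + _); apply: eq_bigr => l _; rewrite mulrC.
apply: aeW => x _; rewrite grp_coefM mulr_sumr [LHS]add0r; apply: eq_bigr => l _.
by rewrite mulrC -!mulrA.
Qed.

End flow.

(** * Reversal and concatenation of paths *)

Section group_of_paths.
Context (R : realType) (T : R).
Hypothesis T_gt0 : 0 < T.
Implicit Types a b : nat -> R -> Cplx R.

Let T_ge0 : 0 <= T := ltW T_gt0.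
Let itvT := in_itvT T_gt0.

Lemma measurable_fun_affine (k s : R) (A : set R) (f : R -> R) : measurable A ->
  (forall x, A x -> k * x + s \in `[0, T]) -> measurable_fun `[0, T] f ->
  measurable_fun A (fun x => f (k * x + s)).
Proof.
move=> mA AT mf; apply: (measurable_comp _ _ mf) => //.
  by move=> _ [x /AT + <-].
apply: measurable_funTS; apply: measurable_funD => //; exact: measurable_funM.
Qed.

Lemma cplxReZ (k : R) (z : Cplx R) : complex.Re ((k%:C)%C * z) = k * complex.Re z.
Proof. by rewrite cplxReM /= mul0r subr0. Qed.
Lemma cplxImZ (k : R) (z : Cplx R) : complex.Im ((k%:C)%C * z) = k * complex.Im z.
Proof. by rewrite cplxImM /= mul0r addr0. Qed.
Lemma normcZ (k : R) (z : Cplx R) : Normc.normc ((k%:C)%C * z) = `|k| * Normc.normc z.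
Proof. by rewrite Normc.normcM /= expr0n /= addr0 sqrtr_sqr. Qed.

Lemma le_exprS (k M : R) i : 1 <= k -> 0 <= M -> k * M ^+ i.+1 <= (k * M) ^+ i.+1.
Proof.
move=> k1 M0; rewrite exprMn ler_wpM2r ?exprn_ge0 //.
by rewrite -[leLHS]expr1 ler_weXn2l.
Qed.

Lemma pathX_reverse a : pathX T a ->
  pathX T (fun i x => ((-1)%:C)%C * a i (-1 * x + T)).
Proof.
move=> /pathXP[ma [M M0 aM]].
have rT x : x \in `[0, T] -> -1 * x + T \in `[0, T].
  by rewrite !in_itv /=; lra.
apply/pathXP; split=> [i|].
  have rev_meas (f : R -> R) : measurable_fun `[0, T] f ->
      measurable_fun `[0, T] (fun x => -1 * f (-1 * x + T)).
    move=> mf; apply: measurable_funM => //; exact: measurable_fun_affine.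
  have [mR mI] := ma i; split.
    by apply: eq_measurable_fun (rev_meas _ mR) => x _; rewrite cplxReZ.
  by apply: eq_measurable_fun (rev_meas _ mI) => x _; rewrite cplxImZ.
exists M => // i; have k0 : -1 != 0 :> R by rewrite oppr_eq0 oner_eq0.
apply: aeS (ae_affine T k0 (aM i)) => x h xT.
by rewrite normcZ normrN1 mul1r; apply: h; exact: rT.
Qed.

(** The path [b] is run first, at double speed: since velocities act on the left, the endpoint is
    that of [a] times that of [b]. *)
Definition concat_path a b : nat -> R -> Cplx R := fun i x =>
  if x <= T / 2 then (2%:C)%C * b i (2 * x + 0) else (2%:C)%C * a i (2 * x + - T).

Lemma pathX_concat a b : pathX T a -> pathX T b -> pathX T (concat_path a b).
Proof.
move=> /pathXP[ma [M M0 aM]] /pathXP[mb [N N0 bN]].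
have mle (D : set R) : measurable_fun D (fun x : R => x <= T / 2).
  by apply: measurable_funTS; exact: measurable_fun_ler.
have concat_meas (f g : R -> R) : measurable_fun `[0, T] f -> measurable_fun `[0, T] g ->
    measurable_fun `[0, T] (fun x => if x <= T / 2 then 2 * g (2 * x + 0) else
      2 * f (2 * x + - T)).
  move=> mf mg; apply: measurable_fun_if => //.
    have mD : measurable (`[0%R, T] `&` (fun x : R => x <= T / 2) @^-1` [set true]).
      exact: mle.
    apply: measurable_funM => //; apply: measurable_fun_affine => // x /= [].
    by rewrite !in_itv /= => /andP[? ?] ?; apply/andP; split; lra.
  have mD : measurable (`[0%R, T] `&` (fun x : R => x <= T / 2) @^-1` [set false]).
    exact: mle.
  apply: measurable_funM => //; apply: measurable_fun_affine => // x /= [].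
  rewrite !in_itv /= => /andP[? ?] /negbT; rewrite -ltNge => ?.
  by apply/andP; split; lra.
apply/pathXP; split=> [i|].
  have [maR maI] := ma i; have [mbR mbI] := mb i; split.
    apply: eq_measurable_fun (concat_meas _ _ maR mbR) => x _.
    by rewrite /concat_path; case: ifP => _; rewrite cplxReZ.
  apply: eq_measurable_fun (concat_meas _ _ maI mbI) => x _.
  by rewrite /concat_path; case: ifP => _; rewrite cplxImZ.
exists (2 * M + 2 * N) => [|i]; first by rewrite addr_ge0 ?mulr_ge0.
have two0 : 2 != 0 :> R by [].
apply: aeS (aeI (ae_affine (- T) two0 (aM i)) (ae_affine 0 two0 (bN i))).
move=> x /= [{}aM {}bN]; rewrite in_itv /= => /andP[x0 xT].
rewrite /concat_path; case: (leP x (T / 2)) => xT2; rewrite normcZ ger0_norm //.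
  apply: (@le_trans _ _ ((2 * N) ^+ i.+1)).
    apply: le_trans (le_exprS _ _ N0); last by lra.
    by rewrite ler_pM2l //; apply: bN; rewrite in_itv /=; apply/andP; split; lra.
  by rewrite lerXn2r ?nnegrE ?addr_ge0 ?mulr_ge0 // lerDr mulr_ge0.
apply: (@le_trans _ _ ((2 * M) ^+ i.+1)).
  apply: le_trans (le_exprS _ _ M0); last by lra.
  by rewrite ler_pM2l //; apply: aM; rewrite in_itv /=; apply/andP; split; lra.
by rewrite lerXn2r ?nnegrE ?addr_ge0 ?mulr_ge0 // lerDl mulr_ge0.
Qed.

Lemma flow0 a F : is_flow T a F -> F 0 = 1%g.
Proof. by case. Qed.

(** Running [a] backwards gives the flow [F (T - x) * (F T)^-1], which ends at [(F T)^-1]. *)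
Lemma group_of_pathsV g : group_of_paths T g -> group_of_paths T (g^-1)%g.
Proof.
move=> [a Ta <-]; exists (fun i x => ((-1)%:C)%C * a i (-1 * x + T)).
  exact: pathX_reverse.
have k0 : -1 != 0 :> R by rewrite oppr_eq0 oner_eq0.
have rT x : x \in `[0, T] -> -1 * x + T \in `[0, T] by rewrite !in_itv /=; lra.
have fl := flow_is_flow T_gt0 Ta.
rewrite (endpointE T_gt0 (is_flow_affine T_gt0 k0 rT fl)).
by rewrite mulN1r addNr (flow0 fl) mul1g.
Qed.

(** The two halves of the concatenated flow [F], rescaled to [[0, T]], are flows of [b] and [a]
    ending at [F (T / 2)] and [F T * (F (T / 2))^-1]. *)
Lemma group_of_pathsM g h :
  group_of_paths T g -> group_of_paths T h -> group_of_paths T (g * h)%g.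
Proof.
move=> [a Ta <-] [b Tb <-]; have Tc := pathX_concat Ta Tb.
exists (concat_path a b) => //.
have fl := flow_is_flow T_gt0 Tc; set F := flow T (concat_path a b) in fl *.
have half0 : 2^-1 != 0 :> R by [].
have lT x : x \in `[0, T] -> 2^-1 * x + 0 \in `[0, T].
  by rewrite !in_itv /= => /andP[? ?]; apply/andP; split; lra.
have rT x : x \in `[0, T] -> 2^-1 * x + T / 2 \in `[0, T].
  by rewrite !in_itv /= => /andP[? ?]; apply/andP; split; lra.
have mulC2 (z : Cplx R) : (2^-1%:C)%C * ((2%:C)%C * z) = z.
  by rewrite mulrA -rmorphM /= mulVf // mul1r.
have flb : is_flow T b (fun x => F (2^-1 * x + 0)%R * (F 0)^-1)%g.
  apply: eq_is_flow (is_flow_affine T_gt0 half0 lT fl) => i; apply: aeW => x.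
  rewrite /= in_itv /= => /andP[x0 xT]; rewrite /concat_path ifT; last by lra.
  by rewrite mulC2; congr (b i _); lra.
have fla : is_flow T a (fun x => F (2^-1 * x + T / 2)%R * (F (T / 2)%R)^-1)%g.
  apply: eq_is_flow (is_flow_affine T_gt0 half0 rT fl) => i.
  (* At [x = 0] the concatenation is evaluated at [T / 2], where it still follows [b]. *)
  apply: aeS (ae_neq (0 : R)) => x xN0.
  rewrite /= in_itv /= => /andP[x0 xT]; rewrite /concat_path ifF; last first.
    by apply/negbTE; rewrite -ltNge; move: x0; rewrite le_eqVlt eq_sym (negPf xN0) /=; lra.
  by rewrite mulC2; congr (a i _); lra.
rewrite (endpointE T_gt0 fl) (endpointE T_gt0 fla) (endpointE T_gt0 flb).
have -> : 2^-1 * T + T / 2 = T by lra.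
have -> : 2^-1 * T + 0 = T / 2 by lra.
by rewrite (flow0 fl) invg1 mulg1 mulgVK.
Qed.

Lemma pathX_cst (c : Cplx R) j : pathX T (fun i _ => (i == j)%:R * c).
Proof.
apply/pathXP; split=> [i|]; first by split; exact: measurable_cst.
exists (1 + Normc.normc c) => [|i]; first by rewrite addr_ge0 ?normc_ge0.
apply: aeW => x _; case: (i == j); rewrite ?mul1r ?mul0r; last first.
  by rewrite Normc.normc0 exprn_ge0 // addr_ge0 ?normc_ge0.
have c1 : 1 <= 1 + Normc.normc c by rewrite lerDl normc_ge0.
by rewrite exprS -[leLHS]mulr1 ler_pM ?normc_ge0 ?exprn_ege1 // lerDr.
Qed.

Lemma cprimitive_id : cprimitive T (fun x => (x%:C)%C) (cst 1).
Proof.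
split; last exact: rprimitive_cst.
split; last by apply: aeW => x _; exact: is_derive_id.
by apply/lipschitzP; exists 1 => // x y _ _; rewrite mul1r.
Qed.

Lemma group_of_paths_letter (c : Cplx R) j : exists2 g, group_of_paths T g &
  forall i, coef [:: i] g = (i == j)%:R * c.
Proof.
(* The constant speed [c / T] in the letter [j] integrates to [c] over [[0, T]]. *)
pose a i (_ : R) : Cplx R := (i == j)%:R * ((T^-1%:C)%C * c).
have Ta : pathX T a by exact: pathX_cst.
have fl := flow_is_flow T_gt0 Ta.
exists (endpoint T a) => [|i]; first by exists a.
rewrite (endpointE T_gt0 fl); have [F0 dF] := (is_flowP _ _ _).1 fl.
have h1 : cprimitive T (fun x => coef [:: i] (flow T a x)) (a i).
  apply: (eq_cprimitive _ _ (dF i [::])) => //; apply: aeW => x _.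
  by rewrite grp_coef_nil mulr1.
have h2 : cprimitive T (fun x => a i 0 * (x%:C)%C) (a i).
  apply: (eq_cprimitive _ _ (cprimitiveZ (a i 0) T_ge0 cprimitive_id)) => //.
  by apply: aeW => x _; rewrite mulr1.
rewrite (cprimitive_eq h1 h2 _ itvT); last by rewrite F0 grp_coef1 mulr0.
rewrite /a -!mulrA; congr (_ * _).
by rewrite mulrCA -rmorphM /= mulVf ?mulr1 // gt_eqF.
Qed.

Lemma group_of_paths1 : group_of_paths T 1%g.
Proof.
have [g Gg _] := group_of_paths_letter 0 0.
by rewrite -(mulgV g); exact: group_of_pathsM Gg (group_of_pathsV Gg).
Qed.

Lemma group_of_paths_subgroup : is_subgroup (group_of_paths T).
Proof.
split; [exact: group_of_paths1|exact: group_of_pathsM|exact: group_of_pathsV].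
Qed.

End group_of_paths.

(** * Shuffle relations *)

(* The sum of f over all shuffles of u and v. *)
Fixpoint shuffle (A : zmodType) (f : word -> A) (u v : word) : A :=
  if u is i :: u' then
    (fix shuffle_right (f : word -> A) (v : word) : A :=
      if v is j :: v' then
        shuffle (fun w => f (i :: w)) u' v + shuffle_right (fun w => f (j :: w)) v'
      else f u) f v
  else f v.

Section shuffle.
Context {A : zmodType}.
Implicit Types (f g : word -> A) (u v : word).

Lemma shuffle_nilr f u : shuffle f u [::] = f u.
Proof. by case: u. Qed.

Lemma shuffle_cons f i u j v : shuffle f (i :: u) (j :: v) =
  shuffle (fun w => f (i :: w)) u (j :: v) + shuffle (fun w => f (j :: w)) (i :: u) v.
Proof. by []. Qed.

(** Shuffles are defined by their first letter; a double induction yields the mirror recursion on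
    the last letter, which Dynkin's formula requires. *)
Lemma shuffle_rcons f i u j v : shuffle f (rcons u i) (rcons v j) =
  shuffle (fun w => f (rcons w i)) u (rcons v j) +
  shuffle (fun w => f (rcons w j)) (rcons u i) v.
Proof.
elim: u v f => [|a u IHu] v f.
  elim: v f => [|b v IHv] f; first by rewrite /= addrC.
  rewrite [rcons [::] i]/= rcons_cons shuffle_cons.
  by rewrite (IHv (fun w => f (b :: w))) !shuffle_cons /= addrCA.
elim: v f => [|b v IHv] f.
  rewrite rcons_cons [rcons [::] j]/= shuffle_cons.
  have /= -> := IHu [::] (fun w => f (a :: w)).
  by rewrite !shuffle_nilr addrAC.
rewrite !rcons_cons shuffle_cons -rcons_cons.
rewrite (IHu _ (fun w => f (a :: w))) -[a :: rcons u i]rcons_cons.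
by rewrite (IHv (fun w => f (b :: w))) !rcons_cons !shuffle_cons addrACA.
Qed.
End shuffle.

Lemma shuffleZ (A : pzRingType) (c : A) (f : word -> A) u v :
  shuffle (fun w => c * f w) u v = c * shuffle f u v.
Proof.
elim: u v f => [//|i u IHu] v f; elim: v f => [|j v IHv] f; first by rewrite !shuffle_nilr.
by rewrite !shuffle_cons mulrDr (IHu _ (fun w => f (i :: w))) (IHv (fun w => f (j :: w))).
Qed.

(* A right-normed bracket expands by moving some letters to the right of its
   innermost letter a, in reverse order and with signs; this turns the resulting
   shuffles back into the original word. *)
Lemma shuffle_rev_primitive (A : pzRingType) (p : word -> A) (P : pred nat) m l a u :
  (forall x y, (0 < size x)%N -> (0 < size y)%N -> (size x + size y)%N = m ->
     all P x -> all P y -> shuffle p x y = 0) ->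
  (size l + (size u).+1)%N = m -> all P l -> P a -> all P u ->
  shuffle (fun w => p (rcons w a)) l (rev u) = (-1) ^+ size u * p (l ++ a :: u).
Proof.
move=> p0; elim: u l a => [|b u IHu] l a lum Pl Pa /=.
  by rewrite shuffle_nilr mul1r cats1.
move=> /andP[Pb Pu].
have szm : (size (rcons l a) + size (rcons (rev u) b))%N = m.
  by rewrite -lum !size_rcons size_rev /=; lia.
(* Sorted by last letter, this vanishing shuffle replaces the end letter [a] by [b], moving [a] into
   [l], at the cost of a sign. *)
have /eqP : shuffle p (rcons l a) (rcons (rev u) b) = 0.
  by apply: p0 => //; rewrite ?size_rcons ?all_rcons ?all_rev ?Pa ?Pb ?Pl ?Pu.
rewrite shuffle_rcons addr_eq0 rev_cons => /eqP ->.
rewrite IHu ?size_rcons ?all_rcons ?Pa ?Pl //; last by rewrite -lum /=; lia.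
by rewrite exprS mulN1r mulNr cat_rcons.
Qed.

Lemma cprimitive_shuffle (R : realType) (T : R) (f g : R -> word -> Cplx R) u v :
  (forall w, cprimitive T (fun x => f x w) (fun x => g x w)) ->
  cprimitive T (fun x => shuffle (f x) u v) (fun x => shuffle (g x) u v).
Proof.
elim: u v f g => [|i u IHu] v f g fg; first exact: fg.
elim: v f g fg => [|j v IHv] f g fg; first exact: fg.
have h1 := IHu (j :: v) _ _ (fun w => fg (i :: w)).
by have := cprimitiveD h1 (IHv _ _ (fun w => fg (j :: w))).
Qed.

(** * Shuffle relations for flows, and their coefficients as iterated integrals *)

Section flow_relations.
Context (R : realType) (T : R).
Hypothesis T_gt0 : 0 < T.
Implicit Types a : nat -> R -> Cplx R.

Let T_ge0 : 0 <= T := ltW T_gt0.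
Let itvT := in_itvT T_gt0.

(** Double induction on the words: the Leibniz rule on the left and the first-letter recursion on
    the right produce the same derivative, and at 0 both sides vanish for nonempty words. *)
Lemma flow_shuffle a F u v : is_flow T a F -> {in `[0, T], forall x,
  coef u (F x) * coef v (F x) = shuffle (fun w => coef w (F x)) u v}.
Proof.
move=> /is_flowP[F0 dF] x; elim: u v x => [|i u IHu] v x.
  by rewrite grp_coef_nil mul1r.
elim: v x => [|j v IHv] x xT; first by rewrite grp_coef_nil mulr1 shuffle_nilr.
have h1 := cprimitiveM T_ge0 (dF i u) (dF j v).
have h2 : cprimitive T
    (fun x => shuffle (fun w => coef (i :: w) (F x)) u (j :: v) +
              shuffle (fun w => coef (j :: w) (F x)) (i :: u) v)
    (fun x => a i x * coef u (F x) * coef (j :: v) (F x) +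
              coef (i :: u) (F x) * (a j x * coef v (F x))).
  have := cprimitiveD
    (cprimitive_shuffle u (j :: v) (fun w => dF i w))
    (cprimitive_shuffle (i :: u) v (fun w => dF j w)).
  apply: eq_cprimitive => //; apply: aeW => y yT.
  transitivity (a i y * shuffle (fun w => coef w (F y)) u (j :: v) +
                a j y * shuffle (fun w => coef w (F y)) (i :: u) v).
    by rewrite -!shuffleZ.
  by rewrite -IHu // -IHv // mulrA; congr (_ + _); rewrite mulrCA.
apply: (cprimitive_eq h1 h2 _ xT).
rewrite -[LHS]/(coef (i :: u) (F 0) * coef (j :: v) (F 0)) F0 !grp_coef1 mul0r.
have sh0 k y z : shuffle (fun w => coef (k :: w) (1%g : grp R)) y z = 0.
  rewrite (_ : (fun w => _) = (fun w => 0 * coef (k :: w) (1%g : grp R))).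
    by rewrite shuffleZ mul0r.
  by apply/funext => w; rewrite grp_coef1 mul0r.
by rewrite -[LHS]addr0; congr (_ + _); rewrite sh0.
Qed.

Lemma iterint_cprimitive a i w : pathX T a ->
  cprimitive T (iterint T a (i :: w)) (fun x => - (a i x * iterint T a w x)).
Proof.
move=> [Ta _]; elim: w i => [|j w IHw] i;
  apply: cprimitive_integral_right => //; apply: LinftyM (Ta i) _.
- exact: cprimitive_Linfty T_ge0 (cprimitive_cst _ _).
- exact: cprimitive_Linfty T_ge0 (IHw j).
Qed.

(* \sum_(w = u ++ v) F_(rev u ++ r)(x) I_v(x), where I_v integrates over [x, T]; it
   interpolates between the iterated integral (x = 0) and the flow (x = T). *)
Fixpoint flow_iterint a (F : R -> grp R) (r w : word) (x : R) : Cplx R :=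
  coef r (F x) * iterint T a w x +
  (if w is i :: v then flow_iterint a F (i :: r) v x else 0).

(** Consecutive summands telescope: differentiating the integral factor of one cancels
    differentiating the flow factor of the next. Only the derivative of the first flow factor
    survives. *)
Lemma flow_iterint_cprimitive a F r w : pathX T a -> is_flow T a F ->
  cprimitive T (flow_iterint a F r w)
    (fun x => (if r is j :: s then a j x * coef s (F x) else 0) * iterint T a w x).
Proof.
move=> Ta /is_flowP[F0 dF].
have dFr (s : word) : cprimitive T (fun x => coef s (F x))
    (fun x => if s is j :: s' then a j x * coef s' (F x) else 0).
  case: s => [|j s]; last exact: dF.
  apply: eq_cprimitive (cprimitive_cst T 1) => [x _|].
    by rewrite grp_coef_nil.
  exact: aeW.
elim: w r => [|i w IHw] r.
  apply: eq_cprimitive (dFr r) => [x _|].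
    by rewrite /= mulr1 addr0.
  by apply: aeW => x _; rewrite /= mulr1.
have := cprimitiveD (cprimitiveM T_ge0 (dFr r) (iterint_cprimitive i w Ta)) (IHw (i :: r)).
apply: eq_cprimitive => //; apply: aeW => x _.
rewrite -[LHS]/(_ * _ + coef r (F x) * - (a i x * iterint T a w x)
  + a i x * coef r (F x) * iterint T a w x).
by rewrite mulrN mulrA [coef r _ * a i x]mulrC -addrA addNr addr0.
Qed.

Lemma coef_endpoint a w : pathX T a -> coef (rev w) (endpoint T a) = iterint T a w 0.
Proof.
move=> Ta; have fl := flow_is_flow T_gt0 Ta; set F := flow T a in fl *.
rewrite (endpointE T_gt0 fl).
have h : cprimitive T (flow_iterint a F [::] w) (cst 0).
  apply: eq_cprimitive (flow_iterint_cprimitive [::] w Ta fl) => //.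
  by apply: aeW => x _; rewrite mul0r.
have := cprimitive_eq h (cprimitive_cst T (flow_iterint a F [::] w 0)) erefl itvT.
(* At [T] only the summand with the empty integral survives; at 0 only the one with the empty flow
   word. *)
have HT r : flow_iterint a F r w T = coef (catrev w r) (F T).
  elim: w r {h} => [|i w IHw] r; first by rewrite /= mulr1 addr0.
  by rewrite /= cintegral_itv_pt mulr0 add0r IHw.
have H0 j r v : flow_iterint a F (j :: r) v 0 = 0.
  by elim: v j r {h HT} => [|i v IHv] j r; rewrite /= (flow0 fl) grp_coef1 mul0r add0r //.
rewrite HT -/(rev w) => ->; case: w {h HT} => [|i w].
  by rewrite /= grp_coef_nil mul1r addr0.
by rewrite [cst _ _]/= H0 grp_coef_nil mul1r addr0.
Qed.

End flow_relations.

(** * Dynkin's formula and commutators *)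

(** The sum runs over the decompositions [v = l ++ a :: u]; below, [a] is the innermost letter of a
    bracket. *)
Fixpoint splits (A : zmodType) (f : word -> nat -> word -> A) (v : word) : A :=
  if v is a :: u then f [::] a u + splits (fun l => f (a :: l)) u else 0.

Section splits.
Context {A : zmodType}.
Implicit Types f g : word -> nat -> word -> A.

Lemma splits_rcons f v e :
  splits f (rcons v e) = splits (fun l a u => f l a (rcons u e)) v + f v e [::].
Proof.
elim: v f => [|c v IHv] f /=; first by rewrite addrC.
by rewrite IHv addrA.
Qed.

Lemma eq_splits f g v :
  (forall l a u, v = l ++ a :: u -> f l a u = g l a u) -> splits f v = splits g v.
Proof.
elim: v f g => [//|c v IHv] f g fg /=; congr (_ + _); first exact: (fg [::]).
by apply: IHv => l a u vE; apply: (fg (c :: l)); rewrite vE.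
Qed.

Lemma splitsB f g v :
  splits (fun l a u => f l a u - g l a u) v = splits f v - splits g v.
Proof.
elim: v f g => [|c v IHv] f g /=; first by rewrite subr0.
by rewrite (IHv (fun l => f (c :: l))) opprD addrACA.
Qed.

Lemma splits_cst (c : A) v : splits (fun _ _ _ => c) v = c *+ size v.
Proof. by elim: v => [//|a v IHv] /=; rewrite IHv mulrS. Qed.
End splits.

(* The coefficient of v in \sum_w q(w) [X_(w_0), [X_(w_1), ... [.., X_(w_k)]]], the sum
   being over the words w of length k.+1. *)
Fixpoint dynkin_coef (A : pzRingType) (k : nat) (q : word -> A) (v : word) : A :=
  if k is k'.+1 then
    if v is c :: v' then
      dynkin_coef k' (fun w => q (c :: w)) v' -
      dynkin_coef k' (fun w => q (last c v' :: w)) (belast c v')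
    else 0
  else q v.

Section dynkin_coef.
Context {A : pzRingType}.
Implicit Types (p q : word -> A) (v : word).

(** In the expanded bracket each outer letter goes to the left of the innermost letter [a], or to
    its right with a minus sign and in reverse order. So [w] yields [l ++ a :: u] exactly through
    shuffles of [l] and [rev u] followed by [a]. *)
Lemma dynkin_coefE k q v : size v = k.+1 -> dynkin_coef k q v =
  splits (fun l a u => (-1) ^+ size u * shuffle (fun w => q (rcons w a)) l (rev u)) v.
Proof.
elim: k v q => [|k IHk] v q; first by case: v => [|c []] //= _; rewrite mul1r addr0.
case: v => [//|c v] [szv]; case/lastP: v szv => [//|x e]; rewrite size_rcons => -[szx].
rewrite [LHS]/= last_rcons belast_rcons !IHk ?size_rcons /= ?szx //.
rewrite !splits_rcons /=.
(* When the innermost letter is neither [c] nor [e], the outermost one is [c] or [e], and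
   [shuffle_cons] separates these cases; the two extreme splits are matched apart. *)
rewrite [in RHS](@eq_splits _ (fun l a u => (-1) ^+ size (rcons u e) *
    shuffle (fun w => q (rcons w a)) (c :: l) (rev (rcons u e)))
  (fun l a u => (-1) ^+ size (rcons u e) *
     shuffle (fun w => q (c :: rcons w a)) l (rev (rcons u e)) -
   (-1) ^+ size u * shuffle (fun w => q (e :: rcons w a)) (c :: l) (rev u))); last first.
  move=> l a u _; rewrite rev_rcons shuffle_cons size_rcons mulrDr exprS mulN1r.
  by rewrite !mulNr; congr (_ - _).
rewrite splitsB rev_rcons !shuffle_nilr /= ?size_rcons exprS mulN1r mulNr.
rewrite opprD addrACA [_ + - (_ * _)]addrC -addrA; congr (_ + _).
  by rewrite szx.
by rewrite -addrA; congr (_ + _); exact: addrC.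
Qed.

Lemma dynkin_coefZ (c : A) k q v : dynkin_coef k (fun w => c * q w) v = c * dynkin_coef k q v.
Proof.
elim: k q v => [//|k IHk] q [|a v] /=; first by rewrite mulr0.
by rewrite mulrBr -!IHk.
Qed.

(* Dynkin-Specht-Wever *)
Lemma dynkin_coef_primitive (P : pred nat) k p v :
  (forall x y, (0 < size x)%N -> (0 < size y)%N -> (size x + size y)%N = k.+1 ->
     all P x -> all P y -> shuffle p x y = 0) ->
  size v = k.+1 -> all P v -> dynkin_coef k p v = p v *+ k.+1.
Proof.
move=> p0 szv Pv; rewrite dynkin_coefE // -szv -splits_cst.
apply: eq_splits => l a u vE; move: szv Pv.
rewrite vE size_cat all_cat /= => sz /and3P[Pl Pa Pu].
(* The two signs cancel, so each of the k+1 splits contributes [p v]. *)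
rewrite (shuffle_rev_primitive p0 sz) // mulrA -exprD addnn -mul2n exprM sqrrN.
by rewrite !expr1n mul1r.
Qed.
End dynkin_coef.

(** * Lowest terms of products and commutators *)

Section order.
Context {R : realType}.
Implicit Types (f g : ncseries R) (x y : grp R) (w : word).

(* The lowest term of a product; for shorter w both sides vanish. *)
Lemma smul_lowest f g (a b : nat) w :
  (forall w, (size w < a)%N -> f w = 0) -> (forall w, (size w < b)%N -> g w = 0) ->
  (size w <= a + b)%N -> (f * g) w = f (take a w) * g (drop a w).
Proof.
move=> f0 g0 wab; rewrite smulE.
have [aw|wa] := ltnP a (size w).+1; last first.
  rewrite [f (take a w)]f0 ?mul0r ?big1 // => [k _|].
    by rewrite f0 ?mul0r // size_take_min; have := ltn_ord k; lia.
  by rewrite size_take_min; lia.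
rewrite (bigD1 (Ordinal aw)) //= big1 ?addr0 // => k; rewrite -val_eqE /= => ka.
have [kla|kga] := ltnP k a.
  by rewrite f0 ?mul0r // size_take_min; lia.
by rewrite [g _]g0 ?mulr0 // size_drop; have := ltn_ord k; lia.
Qed.

(** [x - 1] starts at words of length m+1; length counts letters, like the order of an iterated
    integral, and not the exponent of t. *)
Definition coef_vanish (m : nat) (x : grp R) :=
  forall w, (0 < size w <= m)%N -> coef w x = 0.

Lemma coef_vanish0 x : coef_vanish 0 x.
Proof. by move=> w /andP[w0]; rewrite leqNgt w0. Qed.

Lemma coef_vanish_sub1 m x w : coef_vanish m x -> (size w < m.+1)%N ->
  (grp_val x - 1) w = 0.
Proof.
move=> xm wm; rewrite -[LHS]/(coef w x - coef w (1%g : grp R)).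
case: w wm => [|i w] wm; first by rewrite !grp_coef_nil subrr.
by rewrite xm // grp_coef1 subr0.
Qed.

(** Write [x * y] as [(x - 1) * y + y]; as [y] has constant coefficient 1, the first summand agrees
    with [x - 1] up to length m+1. *)
Lemma coef_mul_vanish m x y w : coef_vanish m x -> (0 < size w <= m.+1)%N ->
  coef w (x * y)%g = coef w x + coef w y.
Proof.
move=> xm /andP[w0 wm].
have -> : coef w (x * y)%g = ((grp_val x - 1) * grp_val y) w + coef w y.
  by rewrite mulrBl mul1r -[RHS]/(coef w (x * y)%g - coef w y + coef w y) subrK.
rewrite (@smul_lowest _ _ m.+1 0) ?addn0 //; last by move=> ? /(coef_vanish_sub1 xm).
rewrite take_oversize // drop_oversize // (eqP (grp_valP y)) mulr1.
rewrite -[X in X + _]/(coef w x - coef w (1%g : grp R)) grp_coef1.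
by case: w w0 {wm} => //= i w _; rewrite subr0.
Qed.

Lemma coef_inv_vanish m x w : coef_vanish m x -> (0 < size w <= m.+1)%N ->
  coef w (x^-1)%g = - coef w x.
Proof.
move=> xm wm; apply/eqP; rewrite -addr_eq0 addrC -(coef_mul_vanish _ xm wm) mulgV.
by rewrite grp_coef1; case: w wm.
Qed.

Lemma coef_vanish_subgroup m : is_subgroup [set x : grp R | coef_vanish m x].
Proof.
split=> [w /andP[w0 _]|x y xm ym w wm|x xm w wm].
- by rewrite grp_coef1; case: w w0.
- have wm' : (0 < size w <= m.+1)%N by move: wm => /andP[-> /leqW].
  by rewrite (coef_mul_vanish _ xm wm') xm ?ym ?addr0.
- have wm' : (0 < size w <= m.+1)%N by move: wm => /andP[-> /leqW].
  by rewrite (coef_inv_vanish xm wm') xm ?oppr0.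
Qed.

(* y x ([~ x, y] - 1) = x y - y x = (x - 1)(y - 1) - (y - 1)(x - 1). *)
Lemma coef_commg m x y w : coef_vanish m y -> (size w <= m.+2)%N ->
  (grp_val [~ x, y]%g - 1) w =
  (grp_val x - 1) (take 1 w) * (grp_val y - 1) (drop 1 w) -
  (grp_val y - 1) (take m.+1 w) * (grp_val x - 1) (drop m.+1 w).
Proof.
move=> ym wm; pose X := grp_val x - 1; pose Y := grp_val y - 1.
have X0 w' : (size w' < 1)%N -> X w' = 0 by exact/coef_vanish_sub1/coef_vanish0.
have Y0 w' : (size w' < m.+1)%N -> Y w' = 0 by exact: coef_vanish_sub1.
have EE w' : (size w' <= m.+2)%N ->
    (X * Y - Y * X) w' = X (take 1 w') * Y (drop 1 w') - Y (take m.+1 w') * X (drop m.+1 w').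
  move=> wm'; rewrite -[LHS]/((X * Y) w' - (Y * X) w').
  by rewrite (smul_lowest X0 Y0) // (smul_lowest Y0 X0) ?addn1 //.
rewrite -/X -/Y -EE //.
(* The factor [(y * x)^-1] has constant coefficient 1 and so leaves the lowest term unchanged. *)
have -> : grp_val [~ x, y]%g - 1 = grp_val ((y * x)^-1)%g * (X * Y - Y * X).
  have -> : X * Y - Y * X = grp_val (y * x)%g * (grp_val [~ x, y]%g - 1).
    have yxz : grp_val (y * x)%g * grp_val [~ x, y]%g = grp_val x * grp_val y.
      by rewrite -[RHS]/(grp_val (x * y)%g) (commgC x y).
    have zmod (V : zmodType) (p q r s u : V) : p - r - (s - u) - (q - s - (r - u)) = p - q.
      rewrite -[p - r - _]addrA -opprD -[q - s - _]addrA -opprD.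
      by rewrite [s + (r - u)]addrCA opprB [LHS]addrA subrK.
    by rewrite [RHS]mulrBr mulr1 yxz /X /Y !mulrBl !mulrBr !mul1r !mulr1 zmod.
  by rewrite mulrA -[_ * grp_val _]/(grp_val ((y * x)^-1 * (y * x))%g) mulVg mul1r.
rewrite (@smul_lowest _ _ 0 m.+2) //; first by rewrite take0 drop0 (eqP (grp_valP _)) mul1r.
move=> w' wm'; rewrite EE; last exact: ltnW.
have [w0|w0] := leqP (size w') 0.
  by rewrite X0 ?mul0r ?Y0 ?mul0r ?subr0 // size_take_min; lia.
by rewrite [Y (drop _ _)]Y0 ?mulr0 ?[X (drop _ _)]X0 ?mulr0 ?subr0 // size_drop; lia.
Qed.

Lemma commg_vanish m x y : coef_vanish m y -> coef_vanish m.+1 [~ x, y]%g.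
Proof.
move=> ym w /andP[w0 wm]; have := coef_commg x ym (leqW wm).
rewrite [(grp_val y - 1) (drop 1 w)](coef_vanish_sub1 ym); last first.
  by rewrite size_drop; lia.
rewrite [(grp_val x - 1) (drop m.+1 w)](coef_vanish_sub1 (@coef_vanish0 x)); last first.
  by rewrite size_drop; lia.
rewrite !mulr0 subr0 -[X in X = _]/(coef w [~ x, y]%g - coef w (1%g : grp R)).
by rewrite grp_coef1; case: w w0 {wm} => // i w _; rewrite subr0.
Qed.

(** The lowest term of a group commutator is the Lie bracket of the lowest terms, matching the
    recursion of [dynkin_coef]. *)
Lemma coef_commg_lowest m x y c v : coef_vanish m y -> size v = m.+1 ->
  coef (c :: v) [~ x, y]%g =
  coef [:: c] x * coef v y - coef (belast c v) y * coef [:: last c v] x.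
Proof.
move=> ym szv.
have sub1 (z : grp R) u : u != [::] -> (grp_val z - 1) u = coef u z.
  move=> u0; rewrite -[LHS]/(coef u z - coef u (1%g : grp R)) grp_coef1 (negPf u0).
  exact: subr0.
have tE : take m.+1 (c :: v) = belast c v.
  by rewrite lastI -cats1 take_size_cat ?size_belast.
have dE : drop m.+1 (c :: v) = [:: last c v].
  by rewrite lastI -cats1 drop_size_cat ?size_belast.
have v0 : v != [::] by rewrite -size_eq0 szv.
have b0 : belast c v != [::] by rewrite -size_eq0 size_belast szv.
rewrite -sub1 // (coef_commg x ym); last by rewrite /= szv.
by rewrite tE dE [take _ _]/= take0 drop1 !sub1.
Qed.
End order.

(** * Generalities on the lower central series *)

Section lower_central.
Context {gT : groupType}.
Implicit Types (H K : set gT) (x y : gT).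

Lemma commutator_subgroup_subgroup H K : is_subgroup (commutator_subgroup H K).
Proof.
split=> [M [[M1 _ _] _] //|x y Hx Hy M MP|x Hx M MP].
- have [[_ MM _] _] := MP; apply: MM; [exact: Hx|exact: Hy].
- have [[_ _ MV] _] := MP; apply: MV; exact: Hx.
Qed.

Lemma commg_commutator_subgroup H K x y :
  H x -> K y -> commutator_subgroup H K [~ x, y]%g.
Proof. by move=> Hx Ky M [_]; apply; exists x => //; exists y. Qed.

Lemma commutator_subgroup_sub H K (M : set gT) : is_subgroup M ->
  (forall x y, H x -> K y -> M [~ x, y]%g) -> commutator_subgroup H K `<=` M.
Proof. by move=> sM HKM z; apply; split=> // _ [x Hx [y Ky <-]]; exact: HKM. Qed.

Lemma commutator_subgroupS H H' K K' : H `<=` H' -> K `<=` K' ->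
  commutator_subgroup H K `<=` commutator_subgroup H' K'.
Proof.
move=> HH' KK'; apply: commutator_subgroup_sub.
  exact: commutator_subgroup_subgroup.
by move=> x y /HH' Hx /KK' Ky; exact: commg_commutator_subgroup.
Qed.

Lemma lower_centralS H H' n : H `<=` H' -> lower_central H n `<=` lower_central H' n.
Proof. by move=> HH'; elim: n => // n IHn; exact: commutator_subgroupS. Qed.

Lemma lower_central_subgroup H n : is_subgroup H -> is_subgroup (lower_central H n).
Proof. by case: n => // n _; exact: commutator_subgroup_subgroup. Qed.

Lemma lower_central_le H m n : is_subgroup H -> (n <= m)%N ->
  lower_central H m `<=` lower_central H n.
Proof.
move=> sH; have step k : lower_central H k.+1 `<=` lower_central H k.
  elim: k => [|k IHk]; last exact: commutator_subgroupS.
  apply: commutator_subgroup_sub => // x y Hx Hy; case: sH => _ HM HV.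
  by apply: (HM); [exact: HV|apply: (HM); [exact: HV|exact: HM]].
elim: m => [|m IHm]; first by rewrite leqn0 => /eqP ->.
rewrite leq_eqVlt => /predU1P[-> //|/IHm]; exact: subset_trans.
Qed.
End lower_central.

Lemma lower_central_vanish (R : realType) (H : set (grp R)) n g :
  lower_central H n g -> coef_vanish n g.
Proof.
elim: n g => [|n IHn] g; first by move=> _; exact: coef_vanish0.
apply: (commutator_subgroup_sub (coef_vanish_subgroup n.+1)) => x y _ /IHn.
exact: commg_vanish.
Qed.

(** * Realising Lie polynomials by iterated group commutators *)

Section realize.
Context {R : realType}.
Variable H : set (grp R).
Hypothesis sH : is_subgroup H.
Hypothesis letterH : forall (c : Cplx R) j, exists2 g, H g &
  forall i, coef [:: i] g = (i == j)%:R * c.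

(** Elements of the k-th term have no coefficients of lengths 1 to k, so at length k+1
    multiplication becomes addition. *)
Lemma lower_central_coef_sum k d (P : word -> Prop) (f : nat -> word -> Cplx R) :
  (forall b, (b < d)%N -> exists2 h, lower_central H k h &
     forall v, size v = k.+1 -> P v -> coef v h = f b v) ->
  exists2 h, lower_central H k h &
    forall v, size v = k.+1 -> P v -> coef v h = \sum_(b < d) f b v.
Proof.
have [lc1 lcM _] := lower_central_subgroup k sH.
elim: d => [|d IHd] fH.
  by exists 1%g => // v; rewrite big_ord0 grp_coef1; case: v.
have [|h1 lh1 h1E] := IHd; first by move=> b bd; exact/fH/ltnW.
have [h2 lh2 h2E] := fH d (ltnSn _).
exists (h1 * h2)%g; first exact: lcM.
move=> v szv Pv; rewrite big_ord_recr [RHS]/= -h1E // -h2E //.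
by rewrite (coef_mul_vanish _ (lower_central_vanish lh1)) // szv leqnn.
Qed.

Lemma sum_pred1 d a (f : nat -> Cplx R) : (a < d)%N ->
  \sum_(b < d) (a == b)%:R * f b = f a.
Proof.
move=> ad; rewrite (bigD1 (Ordinal ad)) //= eqxx mul1r big1 ?addr0 // => b.
by rewrite -val_eqE /= eq_sym => /negPf ->; rewrite mul0r.
Qed.

(** By induction, the brackets with outermost letter [b] come from the commutator of a letter
    element for [b] with an element realising the inner brackets. Restricting to letters below [d]
    makes the product over [b] finite. *)
Lemma dynkin_coef_realize d k (q : word -> Cplx R) : exists2 h, lower_central H k h &
  forall v, size v = k.+1 -> all (fun i => i < d)%N v -> coef v h = dynkin_coef k q v.
Proof.
elim: k q => [|k IHk] q.
  have [b _|h lh hE] := @lower_central_coef_sum 0 d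
      (fun v => all (fun i => i < d)%N v) (fun b v => (head 0%N v == b)%:R * q [:: b]).
    by have [g Hg gE] := letterH (q [:: b]) b; exists g => // -[|i []].
  exists h => // v szv vd; rewrite hE //.
  by case: v szv vd => [|a []] //= _; rewrite andbT => ad; rewrite (sum_pred1 (fun b => q [:: b])).
(* The defaults of [head] and [last] are never reached, the words having length k+2. *)
have [b bd|h lh hE] := @lower_central_coef_sum k.+1 d
    (fun v => all (fun i => i < d)%N v)
    (fun b v => (head 0%N v == b)%:R * dynkin_coef k (fun w => q (b :: w)) (behead v) -
      (last 0%N v == b)%:R * dynkin_coef k (fun w => q (b :: w)) (belast (head 0%N v) (behead v))).
  have [x Hx xE] := letterH 1 b; have [y ly yE] := IHk (fun w => q (b :: w)).
  exists [~ x, y]%g; first exact: commg_commutator_subgroup.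
  move=> [//|c v] [szv] cvd; have /andP[_ vd] := cvd.
  rewrite (@coef_commg_lowest _ k) //; last exact: lower_central_vanish ly.
  rewrite !xE !mulr1 yE // yE ?size_belast //; last first.
    by move: cvd; rewrite lastI all_rcons => /andP[].
  by congr (_ - _); rewrite mulrC.
exists h => // v szv vd; rewrite hE //; case: v szv vd {hE} => [//|c v] [szv] vd.
have ld : (last c v < d)%N by move: vd; rewrite lastI all_rcons => /andP[].
rewrite [dynkin_coef k.+1 q _]/= sumrB /=.
rewrite (@sum_pred1 d c (fun b => dynkin_coef k (fun w => q (b :: w)) v)); last by case/andP: vd.
by rewrite (@sum_pred1 d (last c v) (fun b => dynkin_coef k (fun w => q (b :: w)) (belast c v))).
Qed.

(* The lowest term of h^-1 g is primitive by the shuffle relations, hence a Lie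
   polynomial, and so is removed by an iterated commutator. *)
Lemma lower_central_approx n g :
  (forall h u v, H h -> coef u (h * g)%g * coef v (h * g)%g =
     shuffle (fun w => coef w (h * g)%g) u v) ->
  coef_vanish n g -> forall m d, exists2 h, lower_central H n h &
    forall w, (size w <= m)%N -> all (fun i => i < d)%N w -> coef w h = coef w g.
Proof.
move=> gsh gn m d; have slc := lower_central_subgroup n sH; have [lc1 lcM lcV] := slc.
have lcH := lower_central_le sH (leq0n n).
(* Up to length [n] the unit already agrees with [g]; beyond that, one length is corrected at a
   time. *)
have [mn|] := leqP m n.
  exists 1%g => // -[|i w] wm _; first by rewrite !grp_coef_nil.
  by rewrite grp_coef1 gn //= (leq_trans wm).
elim: m => // m IHm; rewrite ltnS => nm.
have [h lh hE] : exists2 h, lower_central H n h &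
    forall w, (size w <= m)%N -> all (fun i => i < d)%N w -> coef w h = coef w g.
  move: nm; rewrite leq_eqVlt => /predU1P[<-|/IHm//].
  exists 1%g => // -[|i w] wm _; first by rewrite !grp_coef_nil.
  by rewrite grp_coef1 gn.
pose g' := (h^-1 * g)%g; pose p w := coef w g'.
have g'0 w : (0 < size w <= m)%N -> all (fun i => i < d)%N w -> coef w g' = 0.
  move=> /andP[w0 wm] wd; transitivity (coef w (h^-1 * h)%g); last first.
    by rewrite mulVg grp_coef1; case: w w0 {wm wd}.
  rewrite !grp_coefM; apply: eq_bigr => k _; rewrite hE //.
    by rewrite size_drop (leq_trans (leq_subr _ _)).
  by move: wd; rewrite -{1}[w](cat_take_drop k) all_cat => /andP[].
(* The shuffle equals a product of coefficients of [g'] at two nonempty words of length at most [m],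
   which vanish. *)
have psh x y : (0 < size x)%N -> (0 < size y)%N -> (size x + size y)%N = m.+1 ->
    all (fun i => i < d)%N x -> all (fun i => i < d)%N y -> shuffle p x y = 0.
  move=> x0 y0 xym xd yd; rewrite -gsh; last exact/lcH/lcV.
  by rewrite -/g' g'0 ?mul0r // x0 /=; lia.
(* The factor 1/(m+1) compensates the multiple m+1 in the Dynkin-Specht-Wever identity. *)
have [r lr rE] := dynkin_coef_realize d m (fun w => m.+1%:R^-1 * p w).
have rn := lower_central_le sH nm lr.
have {}rE w : (size w <= m.+1)%N -> all (fun i => i < d)%N w -> coef w r = coef w g'.
  case: w => [|i w] wm wd; first by rewrite !grp_coef_nil.
  move: wm; rewrite leq_eqVlt => /predU1P[wm|wm]; last first.
    by rewrite g'0 // (lower_central_vanish lr).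
  rewrite rE // dynkin_coefZ (dynkin_coef_primitive psh) //.
  by rewrite -[p _ *+ _]mulr_natl mulrA mulVf ?mul1r // pnatr_eq0.
exists (h * r)%g; first exact: lcM.
move=> w wm wd; rewrite -[g](mulVKg h) -/g' !grp_coefM.
apply: eq_bigr => k _; congr (_ * _); apply: rE.
  by rewrite size_drop (leq_trans (leq_subr _ _)).
by move: wd; rewrite -{1}[w](cat_take_drop k) all_cat => /andP[].
Qed.
End realize.

(** * Topology *)

Lemma closure_eq_continuous (R : realType) (X : topologicalType) (A : set X)
    (f g : X -> Cplx R) : continuous f -> continuous g ->
  (forall x, A x -> f x = g x) -> forall x, closure A x -> f x = g x.
Proof.
move=> cf cg fg x Ax; apply/eqP; rewrite -subr_eq0; apply/eqP.
have cB : closed ((fun y => f y - g y) @^-1` [set 0 : Cplx R]).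
  apply: closed_comp => [y _|]; first by apply: cvgB; [exact: cf|exact: cg].
  exact/accessible_closed_set1/hausdorff_accessible/norm_hausdorff.
suff : closure A `<=` (fun y => f y - g y) @^-1` [set 0 : Cplx R] by apply.
rewrite [X in _ `<=` X]((closure_id _).1 cB); apply: closure_subset => y /fg /= ->.
by rewrite subrr.
Qed.

(** Points outside [D] are isolated in [subspace D], and at points of [D] neighbourhoods are traces
    on [D]. *)
Lemma closure_subspaceE (X : topologicalType) (A D : set X) (x : X) : A `<=` D ->
  closure (A : set (subspace D)) x <-> closure A x /\ D x.
Proof.
move=> AD; split=> [Ax|[Ax Dx] B].
  have Dx : D x.
    apply: contrapT => nDx; apply/nDx/AD.
    have [|y [Ay <-//]] := Ax [set x].
    by case: (nbhs_subspaceP D x) => // _ y.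
  split=> // B Bx; apply: Ax.
  by case: (nbhs_subspaceP D x) => // _; exact: cvg_within Bx.
case: (nbhs_subspaceP D x) => // _ /Ax[y [Ay DB]].
by exists y; split=> //; exact/DB/AD.
Qed.

Section coef_topology.
Context {R : realType}.

Lemma coef_continuous w : continuous (coef w : grp R -> Cplx R).
Proof.
move=> g; apply: (@continuous_comp (grp R) (ncseries R) (Cplx R) (@grp_val R) (fun f => f w)).
  exact: initial_continuous.
exact: proj_continuous.
Qed.

Lemma coef_mul_continuous (h : grp R) w : continuous (fun g : grp R => coef w (h * g)%g).
Proof.
move=> g; apply: (@cvg_big (Cplx R) 'I_(size w).+1 +%R 0 predT add_continuous _ (nbhs g)
  (index_enum _) (fun k (x : grp R) => coef (take k w) h * coef (drop k w) x)).
by move=> k _; apply: cvgM; [exact: cvg_cst|exact: coef_continuous].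
Qed.

Lemma shuffle_continuous (X : topologicalType) (f : X -> word -> Cplx R) u v :
  (forall w, continuous (fun x => f x w)) -> continuous (fun x => shuffle (f x) u v).
Proof.
elim: u v f => [|i u IHu] v f cf; first exact: cf.
elim: v f cf => [|j v IHv] f cf; first exact: cf.
have h1 := IHu (j :: v) _ (fun w => cf (i :: w)).
have h2 := IHv _ (fun w => cf (j :: w)).
move=> x; exact: (cvgD (h1 x) (h2 x)).
Qed.

(** Taking m = d = k gives a sequence in [A] that converges to [g] coefficientwise, each word being
    covered for large [k]. *)
Lemma closure_coef (A : set (grp R)) (g : grp R) :
  (forall m d, exists2 h, A h & forall w, (size w <= m)%N ->
     all (fun i => i < d)%N w -> coef w h = coef w g) -> closure A g.
Proof.
move=> gA.
have [h hA hE] : exists2 h : nat -> grp R, forall k, A (h k) & forall k w,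
    (size w <= k)%N -> all (fun i => i < k)%N w -> coef w (h k) = coef w g.
  have /choice[h hP] k : exists x, A x /\ forall w,
      (size w <= k)%N -> all (fun i => i < k)%N w -> coef w x = coef w g.
    by have [x] := gA k k; exists x.
  by exists h => k; have [] := hP k.
have hg w : \forall k \near \oo, grp_val (h k) w = grp_val g w.
  near=> k; apply: hE; first by near: k; exact: nbhs_infty_ge.
  apply/allP => i iw; apply: (@leq_ltn_trans (\max_(j <- w) j)).
    exact: (leq_bigmax_seq i).
  by near: k; exact: nbhs_infty_gt.
have cvgh : (fun k => grp_val (h k)) @ \oo --> (grp_val g : ncseries R).
  apply/cvg_sup => w U [_ [[B _ <-] Bg] BU].
  apply: filterS (hg w) => k hk; apply: BU.
  by rewrite /= hk.
move=> U [_ [[B oB <-] Bg] BU].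
have [k _ kB] := cvgh B (open_nbhs_nbhs (conj oB Bg)).
by exists (h k); split; [exact: hA|apply: BU; exact: (kB k (leqnn k))].
Unshelve. all: by end_near. Qed.
End coef_topology.

(** * Closures of lower central terms in the two path groups *)

Section formal_paths.
Context {R : realType} (T : R).
Hypothesis T_gt0 : 0 < T.
Implicit Types (g h : grp R) (H : set (grp R)).

Let sG : is_subgroup (group_of_paths T) := group_of_paths_subgroup T_gt0.

Lemma sub_formal_paths : group_of_paths T `<=` formal_paths T.
Proof. exact: subset_closure. Qed.

(** The relations are closed conditions on [g] and hold for paths; the left factor [h] allows for
    division by approximants. *)
Lemma formal_paths_shuffle g h u v : formal_paths T g -> group_of_paths T h ->
  coef u (h * g)%g * coef v (h * g)%g = shuffle (fun w => coef w (h * g)%g) u v.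
Proof.
move=> Tg Th; have c1 : continuous (fun g : grp R => coef u (h * g)%g * coef v (h * g)%g).
  by move=> x; exact: (cvgM (@coef_mul_continuous R h u x) (@coef_mul_continuous R h v x)).
have c2 : continuous (fun g : grp R => shuffle (fun w => coef w (h * g)%g) u v).
  by apply: shuffle_continuous => w; exact: coef_mul_continuous.
apply: (closure_eq_continuous c1 c2 _ Tg) => x Tx.
have [_ GM _] := sG; have [a Ta <-] := GM _ _ Th Tx.
have fl := flow_is_flow T_gt0 Ta.
by rewrite (endpointE T_gt0 fl) (flow_shuffle T_gt0 _ _ fl) // in_itvT.
Qed.

(** The coefficient at the reversed word is one continuous extension, and density of the paths makes
    it the only one on [formal_paths T]. *)
Lemma basic_integralE w g : formal_paths T g -> basic_integral T w g = coef (rev w) g.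
Proof.
move=> Tg; have cw : {within formal_paths T, continuous (coef (rev w) : grp R -> Cplx R)}.
  by apply: continuous_subspaceT; exact: coef_continuous.
rewrite /basic_integral; case: xgetP => [phi _ [cphi phiE]|/(_ (coef (rev w)))].
  have cT : closure (group_of_paths T : set (subspace (formal_paths T))) g.
    by apply/closure_subspaceE; [exact: sub_formal_paths|split].
  apply: (closure_eq_continuous cphi cw _ cT).
  by move=> _ [a Ta <-]; apply: etrans (phiE a Ta) _; rewrite -(coef_endpoint T_gt0 w Ta).
by case; split=> // a Ta; rewrite coef_endpoint.
Qed.

Lemma closure_lower_central_vanish H n g :
  closure (lower_central H n) g -> coef_vanish n g.
Proof.
move=> Hg w wn.
have c0 : continuous (cst 0 : grp R -> Cplx R) by exact: cst_continuous.
apply: (closure_eq_continuous (@coef_continuous R w) c0 _ Hg).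
by move=> x /lower_central_vanish; exact.
Qed.

Lemma vanish_closure_lower_central n g : formal_paths T g -> coef_vanish n g ->
  closure (lower_central (group_of_paths T) n) g.
Proof.
move=> Tg gn; apply: closure_coef.
apply: (lower_central_approx sG (group_of_paths_letter T_gt0) _ gn).
by move=> h u v Th; exact: formal_paths_shuffle.
Qed.

(** The criterion is the same for every [H] between the two groups, because the approximating
    commutators are built from paths alone. *)
Lemma closed_lower_centralE H n g : group_of_paths T `<=` H -> H `<=` formal_paths T ->
  H g -> closed_lower_central H n g <-> coef_vanish n g.
Proof.
move=> GH HT Hg; split=> [Hng|gn].
  apply: (@closure_lower_central_vanish H) => B Bg; apply: Hng.
  by case: (nbhs_subspaceP H g) => // _; exact: cvg_within Bg.
have : closure (lower_central (group_of_paths T) n : set (subspace H)) g.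
  apply/closure_subspaceE.
    exact: subset_trans (lower_central_le sG (leq0n n)) GH.
  by split=> //; apply: vanish_closure_lower_central => //; exact: HT.
by apply: closure_subset; exact: lower_centralS.
Qed.

End formal_paths.

Unset Implicit Arguments.

Theorem theorem2p17 (R : realType) (T : R) (T_gt0 : 0 < T)
    (n : nat) (n_gt0 : (0 < n)%N) :
  (forall g : grp R, formal_paths T g ->
     (closed_lower_central (formal_paths T) n g <->
      forall w : word, (1 <= size w <= n)%N -> basic_integral T w g = 0)) /\
  closed_lower_central (group_of_paths T) n =
    closed_lower_central (formal_paths T) n `&` group_of_paths T.
Proof.
(* Both closures are cut out by the same vanishing of coefficients, whence part (2); part (1)
   follows since reversing a word keeps its length. *)
have clf g Tg := closed_lower_centralE T_gt0 n (@sub_formal_paths _ T)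
  (@subset_refl _ (formal_paths T)) (Tg : formal_paths T g).
have clg g Tg := closed_lower_centralE T_gt0 n (@subset_refl _ (group_of_paths T))
  (@sub_formal_paths _ T) (Tg : group_of_paths T g).
split=> [g Tg|].
  rewrite clf //; split=> gn w wn; first by rewrite basic_integralE // gn ?size_rev.
  by rewrite -[w]revK -(basic_integralE T_gt0) // gn // size_rev.
apply/seteqP; split=> g; last first.
  by move=> [Tng Gg]; apply/clg => //; apply/clf => //; exact: sub_formal_paths.
move=> Gng; have Gg : group_of_paths T g.
  have GT := lower_central_le (group_of_paths_subgroup T_gt0) (leq0n n).
  by have [_] := (closure_subspaceE g GT).1 Gng.
split=> //; apply/clf; first exact: sub_formal_paths.
exact/clg.
Qed.
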